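(* Let $X$ be a compact metrizable space and let $\Delta$ be a closed set of Borel probability measures on $X$. (i) If $(X,\Delta)$ has the small boundary property, then for every $f\in \mathrm{C}_{\mathbb R}(X)$ the class of the constant sequence $(f,f,\dots)$ can be approximated arbitrarily well in the C*-norm of $\ell^\infty(\mathrm{C}(X))/J_{2,\omega,\Delta}$ by self-adjoint invertible elements of $\overline{\mathrm{C}(X)}^{\Delta}$. (ii) Conversely, if for every $f\in \mathrm{C}_{\mathbb R}(X)$ the class of the constant sequence $(f,f,\dots)$ can be approximated arbitrarily well in $\|\cdot\|_{2,\omega,\Delta}$ by self-adjoint invertible elements of $\overline{\mathrm{C}(X)}^{\Delta}$, then $(X,\Delta)$ has the small boundary property.
   Context: Measures act as traces $\tau_\mu(f)=\int f\,d\mu$; ''closed'' is in the weak* topology. $\mathrm{C}_{\mathbb R}(X)$ denotes real-valued continuous functions. $\omega$ is a free ultrafilter on $\mathbb N$; $J_{2,\omega,\Delta}=\{(f_n)\in\ell^\infty(\mathrm{C}(X)):\lim_{n\to\omega}\sup_{\tau\in\Delta}\tau(|f_n|^2)=0\}$; $\|(a_n)\|_{2,\omega,\Delta}=\lim_{n\to\omega}\sup_{\tau\in\Delta}\tau(|a_n|^2)$, which induces a function on the quotient $\ell^\infty(\mathrm{C}(X))/J_{2,\omega,\Delta}$. For $f\in\mathrm{C}(X)$, $\|f\|_{2,\Delta}=\sup_{\mu\in\Delta}(\int|f|^2d\mu)^{1/2}$. $\overline{\mathrm{C}(X)}^{\Delta}$ is the sub-C*-algebra of $\ell^\infty(\mathrm{C}(X))/J_{2,\omega,\Delta}$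 consisting of classes of bounded sequences in $\mathrm{C}(X)$ that are Cauchy for $\|\cdot\|_{2,\Delta}$. $(X,\Delta)$ has the small boundary property if for every $x\in X$ and open $U\ni x$ there is an open neighbourhood $V\subseteq U$ of $x$ with $\mu(\partial V)=0$ for all $\mu\in\Delta$. *)

(* Defs.v *)
From HB Require Import structures.
From mathcomp Require Import all_boot all_order all_algebra.
From mathcomp Require Import all_classical all_reals all_analysis.
From mathcomp Require Import complex.

Set Implicit Arguments.
Unset Strict Implicit.
Unset Printing Implicit Defensive.

Import Order.TTheory GRing.Theory Num.Theory numFieldNormedType.Exports.
Local Open Scope classical_set_scope.
Local Open Scope ring_scope.
Local Open Scope complex_scope.

Section Defs.
Variable R : realType.
Variable X : pseudoPMetricType R.

Definition Borel := g_sigma_algebraType (@open X).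

Definition bprob := probability Borel R.

Definition tau (mu : bprob) (g : X -> R) : R := Rintegral mu [set: Borel] g.

(* weak* closedness of a set of Borel probability measures: every measure
   in the weak*-closure (every basic weak* neighbourhood
   {nu | |tau nu f_i - tau mu f_i| < e, i < k}, f_i in C_R(X), meets Delta)
   belongs to Delta. *)
Definition weak_star_closed (Delta : set bprob) : Prop :=
  forall mu : bprob,
    (forall (k : nat) (fs : nat -> X -> R) (e : R),
        (forall i, (i < k)%N -> continuous (fs i)) -> 0 < e ->
        exists nu, Delta nu /\
          forall i, (i < k)%N -> `|tau mu (fs i) - tau nu (fs i)| < e) ->
    Delta mu.

Definition bdry (V : set X) : set X := closure V `\` interior V.

Definition small_boundary_property (Delta : set bprob) : Prop :=
  forall (x : X) (U : set X), open U -> U x ->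
    exists V : set X, [/\ open V, V x, V `<=` U &
      forall mu : bprob, Delta mu -> mu (bdry V : set Borel) = 0%E].

Definition ccontinuous (f : X -> R[i]) : Prop :=
  continuous (fun x => complex.Re (f x)) /\ continuous (fun x => complex.Im (f x)).
Definition abs2 (z : R[i]) : R := complex.Re z ^+ 2 + complex.Im z ^+ 2.
Definition cabs (z : R[i]) : R := Num.sqrt (abs2 z).

Definition cseq := nat -> X -> R[i].
Definition linfty (a : cseq) : Prop :=
  (forall n, ccontinuous (a n)) /\ exists M : R, forall n x, cabs (a n x) <= M.

Definition csub (a b : cseq) : cseq := fun n x => a n x - b n x.
Definition cadd (a b : cseq) : cseq := fun n x => a n x + b n x.
Definition cmul (a b : cseq) : cseq := fun n x => a n x * b n x.
Definition cstar (a : cseq) : cseq := fun n x => conjc (a n x).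
Definition cone : cseq := fun _ _ => 1.
Definition cconst (f : X -> R) : cseq := fun _ x => (f x)%:C.

Definition sup_tau2 (Delta : set bprob) (g : X -> R[i]) : R :=
  sup [set tau mu (fun x => abs2 (g x)) | mu in Delta].

Definition is_ulim (omega : set_system nat) (s : nat -> R) (L : R) : Prop :=
  forall e : R, 0 < e -> omega [set n | `|s n - L| < e].
Definition ulim (omega : set_system nat) (s : nat -> R) : R :=
  xget 0 [set L | is_ulim omega s L].

Definition free_ultrafilter (omega : set_system nat) : Prop :=
  UltraFilter omega /\ forall A : set nat, finite_set A -> ~ omega A.

Definition inJ (omega : set_system nat) (Delta : set bprob) (a : cseq) : Prop :=
  linfty a /\ is_ulim omega (fun n => sup_tau2 Delta (a n)) 0.

Definition norm2w (omega : set_system nat) (Delta : set bprob) (a : cseq) : R :=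
  ulim omega (fun n => sup_tau2 Delta (a n)).

Definition supnorm (a : cseq) : R :=
  sup [set cabs (a p.1 p.2) | p in [set: nat * X]].
Definition qnorm (omega : set_system nat) (Delta : set bprob) (a : cseq) : R :=
  inf [set supnorm (cadd a j) | j in inJ omega Delta].

Definition norm2D (Delta : set bprob) (f : X -> R[i]) : R :=
  sup [set Num.sqrt (tau mu (fun x => abs2 (f x))) | mu in Delta].

(* bounded sequences of C(X) that are ||.||_{2,Delta}-Cauchy: representatives
   of elements of the subalgebra \overline{C(X)}^Delta *)
Definition in_closure_alg (Delta : set bprob) (b : cseq) : Prop :=
  linfty b /\
  forall e : R, 0 < e -> exists N : nat, forall m n, (N <= m)%N -> (N <= n)%N ->
    norm2D Delta (fun x => b m x - b n x) < e.

Definition sa_invertible (omega : set_system nat) (Delta : set bprob) (b : cseq) : Prop :=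
  [/\ in_closure_alg Delta b,
      inJ omega Delta (csub b (cstar b)) &
      exists c : cseq, [/\ in_closure_alg Delta c,
                           inJ omega Delta (csub (cmul b c) cone) &
                           inJ omega Delta (csub (cmul c b) cone)]].

End Defs.

(* Main.v *)
(** Both directions rest on the zero sets of continuous real functions.

    (i) By the small boundary property and compactness there is an open [W] between
    [{f >= 0}] and [{f > -eta}] whose boundary is null for all of [Delta]; it is the
    positivity set of some [g] vanishing exactly on that boundary. If [s_n] is the
    truncation of [n g] to [[-1, 1]], then [b_n = f + 2 eta s_n] is uniformly close to
    [f], and [|b_n| >= eta] wherever [|g| >= 1/n]. Since [Delta] is weak*-compact, the
    measure of [{|g| < 1/n}] tends to [0] uniformly on [Delta], so [b_n] and
    [b_n / max (b_n^2, eta^2)] are Cauchy in 2-norm and inverse to each other modulo [J].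
    Compactness comes from the Riesz representation of ultralimits of the functionals
    [tau mu_n].

    (ii) If [(b_n)] is close to [f] in 2-norm and invertible modulo [J], some [Re b_n]
    clipped to [[f - eta, f + eta]] is uniformly close to [f] and small only on a set of
    uniformly small measure. A Baire category argument upgrades this to: the functions
    whose zero set is null for all of [Delta] are uniformly dense. For such a [g] close
    to a function separating [x] from the complement of [U], take [V = {g > 0}]. *)
Require Import Defs.
From HB Require Import structures.
From mathcomp Require Import all_boot all_order all_algebra.
From mathcomp Require Import all_classical all_reals all_analysis.
From mathcomp Require Import complex.
From mathcomp Require Import measurable_realfun ring lra.
Import Order.TTheory GRing.Theory Num.Theory numFieldNormedType.Exports.
Local Open Scope classical_set_scope.
Local Open Scope ring_scope.
Set Implicit Arguments.
Unset Strict Implicit.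

(** * Continuous functions on compact spaces *)

Section RealValuedContinuous.
Context (R : realType) (T : topologicalType).
Implicit Types f g : T -> R.

Lemma contD f g : continuous f -> continuous g -> continuous (fun x => f x + g x).
Proof. by move=> cf cg x; apply: continuousD; [exact: cf|exact: cg]. Qed.

Lemma contB f g : continuous f -> continuous g -> continuous (fun x => f x - g x).
Proof. by move=> cf cg x; apply: continuousB; [exact: cf|exact: cg]. Qed.

Lemma contM f g : continuous f -> continuous g -> continuous (fun x => f x * g x).
Proof. by move=> cf cg x; apply: continuousM; [exact: cf|exact: cg]. Qed.

Lemma contC (a : R) : continuous (fun _ : T => a).
Proof. by move=> x; exact: cst_continuous. Qed.

Lemma contN f : continuous f -> continuous (fun x => - f x).
Proof. by move=> cf x; apply: continuousN; exact: cf. Qed.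

Lemma cont_norm f : continuous f -> continuous (fun x => `|f x|).
Proof. by move=> cf x; apply: cvg_norm; exact: cf. Qed.

Lemma cont_min f g : continuous f -> continuous g ->
  continuous (fun x => Num.min (f x) (g x)).
Proof. by move=> cf cg x; apply: continuous_min; [exact: cf|exact: cg]. Qed.

Lemma cont_max f g : continuous f -> continuous g ->
  continuous (fun x => Num.max (f x) (g x)).
Proof. by move=> cf cg x; apply: continuous_max; [exact: cf|exact: cg]. Qed.

Lemma contX f n : continuous f -> continuous (fun x => f x ^+ n).
Proof.
move=> cf; elim: n => [|n IH]; first exact: contC.
by under eq_fun do rewrite exprS; exact: contM.
Qed.

Lemma contV f : continuous f -> (forall x, f x != 0) -> continuous (fun x => (f x)^-1).
Proof. by move=> cf f0 x; apply: continuousV; [exact: f0|exact: cf]. Qed.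

Lemma cont_sum (F : nat -> T -> R) n : (forall i, continuous (F i)) ->
  continuous (fun x => \sum_(i < n) F i x).
Proof.
move=> cF; elim: n => [|n IH].
  by under eq_fun do rewrite big_ord0; exact: contC.
by under eq_fun do rewrite big_ord_recr /=; exact: contD.
Qed.

Lemma open_gt_fun f a : continuous f -> open [set x | a < f x].
Proof.
move=> cf; rewrite (_ : [set _ | _] = f @^-1` [set y | a < y])//.
by apply: open_comp => //; exact: open_gt.
Qed.

Lemma closed_ge_fun f a : continuous f -> closed [set x | a <= f x].
Proof.
move=> cf; rewrite (_ : [set _ | _] = f @^-1` [set y | a <= y])//.
by apply: closed_comp => //; exact: closed_ge.
Qed.

Lemma closed_le_fun f a : continuous f -> closed [set x | f x <= a].
Proof.
move=> cf; rewrite (_ : [set _ | _] = f @^-1` [set y | y <= a])//.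
by apply: closed_comp => //; exact: closed_le.
Qed.

Lemma compact_bounded_fun f : compact [set: T] -> continuous f ->
  exists2 M, 0 < M & forall x, `|f x| <= M.
Proof.
move=> cT cf; have : compact (f @` [set: T]).
  by apply: continuous_compact => //; exact: continuous_subspaceT.
move/compact_bounded => -[M [_ HM]].
exists (Num.max 1 (M + 1)); first by rewrite lt_max ltr01.
move=> x; apply: (HM (Num.max 1 (M + 1))); last by exists x.
by rewrite lt_max ltrDl ltr01 orbT.
Qed.

(** One-sided Dini theorem: since [u] increases with n, an inequality reached at x for an index n
    persists on a neighbourhood of x for all later indices, and the near-covering form of
    compactness makes the index uniform. *)
Lemma Dini_le f (u : nat -> T -> R) (e : R) : compact [set: T] -> 0 < e ->
  continuous f -> (forall n, continuous (u n)) ->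
  (forall m n x, (m <= n)%N -> u m x <= u n x) ->
  (forall x, exists n, f x < u n x + e) ->
  exists n, forall x, f x < u n x + e.
Proof.
move=> cT e0 cf cu mu fu.
have ncT : near_covering [set: T] by apply/compact_near_coveringP.
have := ncT _ \oo (fun n x => f x < u n x + e) _.
case.
  move=> x _; have [n fn] := fu x.
  exists ([set y | 0 < u n y + e - f y], [set m | (n <= m)%N]) => /=.
    split; last by exists n.
    apply: open_nbhs_nbhs; split; last by rewrite /= subr_gt0.
    by apply: open_gt_fun; apply: contB => //; apply: contD => //; exact: contC.
  move=> [y m] /= [ynm nm]; rewrite -subr_gt0 (lt_le_trans ynm)//.
  by rewrite lerD2r lerD2r; exact: mu.
by move=> N _ /(_ N) H; exists N => x; apply: H => //=.
Qed.

End RealValuedContinuous.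

(** * Truncated distance functions and open sets *)

Section ZeroSet.
Context {R : realType} {X : pseudoMetricType R}.

(* The truncation also covers [A = set0], where [edist_inf] is [+oo]. *)
Definition tdist (A : set X) (x : X) : R := fine (Order.min (edist_inf A x) 1%E).

Lemma tdistE A x : (tdist A x)%:E = Order.min (edist_inf A x) 1%E.
Proof.
rewrite /tdist fineK// ge0_fin_numE; last by rewrite le_min edist_inf_ge0 lee_fin ler01.
by rewrite gt_min ltry orbT.
Qed.

Lemma tdist_ge0 A x : 0 <= tdist A x.
Proof. by rewrite -lee_fin tdistE le_min edist_inf_ge0 lee_fin ler01. Qed.

Lemma tdist_eq0 A x : (tdist A x = 0) <-> closure A x.
Proof.
split=> [d0|].
  have e0 : edist_inf A x = 0%E.
    have := tdistE A x; rewrite d0 => /esym; case: leP => // _.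
    by move=> [] /eqP; rewrite oner_eq0.
  move=> B /nbhs_ballP[r /= r0 xrB].
  have fe : edist_inf A x \is a fin_num by rewrite e0.
  have [_ [a Aa <-]] := lb_ereal_inf_adherent r0 fe.
  rewrite -/(edist_inf A x) e0 add0e => /edist_lt_ball /= xra.
  by exists a; split => //; exact: xrB.
move=> clA; apply/eqP; rewrite eq_le tdist_ge0 andbT; apply/ler_addgt0Pl => r r0.
rewrite addr0 -lee_fin tdistE ge_min.
have [a [Aa xra]] := clA _ (nbhsx_ballx x r r0).
apply/orP; left; apply: (@le_trans _ _ (edist (x, a))).
  by apply: ereal_inf_lbound; exists a.
exact: edist_fin.
Qed.

(** The triangle inequality survives truncation at 1, so [tdist A] varies by at most r on a ball of
    radius r. *)
Lemma tdist_continuous A : continuous (tdist A).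
Proof.
have lip r x y : 0 < r -> ball x r y -> tdist A x <= r + tdist A y.
  move=> r0 xry; rewrite -lee_fin EFinD !tdistE.
  have H : (edist_inf A x <= r%:E + edist_inf A y)%E.
    apply: (le_trans (edist_inf_triangle A x y)); rewrite leeD2r//.
    exact: edist_fin.
  have [/le_trans|] := leP (edist_inf A y) 1%E.
    by move=> _; rewrite ge_min H.
  by move=> _; rewrite ge_min -EFinD !lee_fin lerDr (ltW r0) orbT.
move=> x; apply/cvgrPdist_le => r r0.
apply: filterS (nbhsx_ballx x r r0) => y xry.
have := lip _ _ _ r0 xry; have := lip _ _ _ r0 (ball_sym xry).
by rewrite ler_norml; lra.
Qed.

Lemma open_tdist_gt0 {U : set X} : open U -> forall x, U x <-> 0 < tdist (~` U) x.
Proof.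
move=> oU x; have cU : closure (~` U) = ~` U.
  by apply/esym/closure_id; exact: open_closedC.
have := tdist_eq0 (~` U) x; rewrite cU /= => H.
rewrite lt_neqAle tdist_ge0 andbT; split=> [Ux|/eqP].
  by apply/eqP => /esym /H.
by move=> n; apply: contrapT => /H /esym.
Qed.

End ZeroSet.

(** * States on C(X) *)

Section State.
Context {R : realType} {X : pseudoPMetricType R}.

(** Positive unital linear functionals on C_R(X). The functional takes arbitrary functions as
    arguments, but the axioms constrain it only on continuous ones, so both integrals and their
    ultralimits qualify. *)
Record is_state (I : (X -> R) -> R) : Prop := {
  stateL : forall (a : R) (f g : X -> R), continuous f -> continuous g ->
    I (fun x => a * f x + g x) = a * I f + I g;
  state_ge0 : forall f : X -> R, continuous f -> (forall x, 0 <= f x) -> 0 <= I f;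
  state1 : I (fun=> 1) = 1 }.

Context {I : (X -> R) -> R} (sI : is_state I).
Implicit Types f g : X -> R.

Lemma stateD f g : continuous f -> continuous g ->
  I (fun x => f x + g x) = I f + I g.
Proof.
move=> cf cg; rewrite -[I f]mul1r -(stateL sI)//.
by congr I; apply/funext => x; rewrite mul1r.
Qed.

Lemma state_cst a : I (fun=> a) = a.
Proof.
have I0 : I (fun=> 0) = 0.
  have := @stateL _ sI 1 (fun=> 0) (fun=> 0) (@contC _ _ _) (@contC _ _ _).
  by rewrite !mul1r !addr0 => /esym/eqP; rewrite -subr_eq0 addrK => /eqP.
have := @stateL _ sI a (fun=> 1) (fun=> 0) (@contC _ _ _) (@contC _ _ _).
by rewrite (state1 sI) I0 mulr1 !addr0.
Qed.

Lemma stateZ a f : continuous f -> I (fun x => a * f x) = a * I f.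
Proof.
move=> cf; rewrite -[RHS]addr0 -[X in _ + X]state_cst -(stateL sI)//; last exact: contC.
by congr I; apply/funext => x; rewrite addr0.
Qed.

Lemma stateB f g : continuous f -> continuous g ->
  I (fun x => f x - g x) = I f - I g.
Proof.
move=> cf cg; rewrite addrC -mulN1r -(stateL sI)//.
by congr I; apply/funext => x; rewrite mulN1r addrC.
Qed.

Lemma state_le f g : continuous f -> continuous g -> (forall x, f x <= g x) -> I f <= I g.
Proof.
move=> cf cg fg; rewrite -subr_ge0 -stateB//; apply: (state_ge0 sI) => [|x].
  exact: contB.
by rewrite subr_ge0.
Qed.

Lemma state_le_cst f a : continuous f -> (forall x, f x <= a) -> I f <= a.
Proof. by move=> cf fa; rewrite -[leRHS]state_cst state_le//; exact: contC. Qed.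

Lemma state_ge_cst f a : continuous f -> (forall x, a <= f x) -> a <= I f.
Proof. by move=> cf fa; rewrite -[leLHS]state_cst state_le//; exact: contC. Qed.

Lemma state_sum (F : nat -> X -> R) n : (forall i, continuous (F i)) ->
  I (fun x => \sum_(i < n) F i x) = \sum_(i < n) I (F i).
Proof.
move=> cF; elim: n => [|n IH].
  by rewrite big_ord0 -[RHS]state_cst; congr I; apply/funext => x; rewrite big_ord0.
rewrite big_ord_recr /= -IH -stateD//; last exact: cont_sum.
by congr I; apply/funext => x; rewrite big_ord_recr.
Qed.

End State.

(** * Integration against a Borel probability measure as a state *)

Section TauState.
Context {R : realType} {X : pseudoPMetricType R} (cX : compact [set: X]).
Implicit Types (mu : bprob X) (f g : X -> R).

Lemma open_Borel (U : set X) : open U -> measurable (U : set (Borel X)).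
Proof. by move=> oU; exact: sub_sigma_algebra. Qed.

Lemma closed_Borel (C : set X) : closed C -> measurable (C : set (Borel X)).
Proof.
move=> cC; rewrite -(setCK C); apply: measurableC; apply: open_Borel.
exact: closed_openC.
Qed.

Lemma measurable_cont f : continuous f -> measurable_fun [set: Borel X] (f : Borel X -> R).
Proof.
move=> cf; apply: (measurability _ (RGenOpens.measurableE R)).
move=> _ [_ [a [b ->] <-]]; rewrite setTI; apply: open_Borel.
by apply: open_comp => //; exact: interval_open.
Qed.

Lemma integrable_cont mu f : continuous f ->
  mu.-integrable [set: Borel X] (EFin \o (f : Borel X -> R)).
Proof.
move=> cf; have [M M0 fM] := compact_bounded_fun cX cf.
apply: measurable_bounded_integrable => //.
- by rewrite (le_lt_trans (probability_le1 mu measurableT)) ?ltry.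
- exact: measurable_cont.
- exists M; split; first exact: num_real.
  by move=> N MN x _; exact: le_trans (fM x) (ltW MN).
Qed.

Lemma tau_EFin mu f : continuous f ->
  (tau mu f)%:E = (\int[mu]_(x in [set: Borel X]) (f x)%:E)%E.
Proof.
by move=> cf; rewrite /tau /Rintegral fineK//; apply: integrable_fin_num => //;
  exact: integrable_cont.
Qed.

Lemma tau_state mu : is_state (tau mu).
Proof.
split=> [a f g cf cg|f cf f0|].
- rewrite /tau RintegralD ?RintegralZl//; first exact: integrable_cont.
  + by apply: integrable_cont; apply: contM => //; exact: contC.
  + exact: integrable_cont.
- exact: Rintegral_ge0.
- by rewrite /tau Rintegral_cst// mul1r (congr1 fine (probability_setT mu)).
Qed.

Lemma le_mu_tau mu (A : set X) f : measurable (A : set (Borel X)) -> continuous f ->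
  (forall x, 0 <= f x) -> (forall x, A x -> 1 <= f x) ->
  (mu (A : set (Borel X)) <= (tau mu f)%:E)%E.
Proof.
move=> mA cf f0 f1; rewrite tau_EFin//.
have -> : mu (A : set (Borel X)) =
    (\int[mu]_(x in [set: Borel X]) (\1_(A : set (Borel X)) x)%:E)%E.
  by rewrite integral_indic// setIT.
apply: ge0_le_integral => //.
- by apply/measurable_EFinP; apply: measurable_indic.
- by apply/measurable_EFinP; exact: measurable_cont.
- move=> x _; rewrite lee_fin indicE; case: (boolP (x \in A)) => [/set_mem /f1//|_].
  exact: f0.
Qed.

End TauState.

(** * Riesz representation *)

Section Riesz.
Context {R : realType} {X : pseudoPMetricType R} (cX : compact [set: X]).
Context {I : (X -> R) -> R} (sI : is_state I).
Implicit Types (f : X -> R) (U A : set X).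

(** Vanishing off [U] replaces compact support inside [U]; passing to [Num.max (f - e) 0] recovers
    room around the support where it is wanted. *)
Definition below_indic U f : Prop :=
  [/\ continuous f, forall x, 0 <= f x <= 1 & forall x, f x != 0 -> U x].

Definition inner U : \bar R := ereal_sup [set (I f)%:E | f in below_indic U].

Definition outer A : \bar R :=
  ereal_inf [set inner U | U in [set U | open U /\ A `<=` U]].

Lemma inner_ub U f : below_indic U f -> ((I f)%:E <= inner U)%E.
Proof. by move=> Uf; apply: ereal_sup_ubound; exists f. Qed.

Lemma inner_ge0 U : (0 <= inner U)%E.
Proof.
have <- : (I (fun=> 0))%:E = 0%E by rewrite (state_cst sI).
apply: inner_ub; split; first exact: contC.
- by move=> _; rewrite lexx ler01.
- by move=> x; rewrite eqxx.
Qed.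

Lemma inner_le1 U : (inner U <= 1)%E.
Proof.
apply: ge_ereal_sup => _ [f [cf f01 _] <-]; rewrite lee_fin.
by apply: (state_le_cst sI) => // x; case/andP: (f01 x).
Qed.

Lemma le_inner U V : U `<=` V -> (inner U <= inner V)%E.
Proof.
move=> UV; apply: ge_ereal_sup => _ [f [cf f01 fU] <-]; apply: inner_ub.
by split => // x /fU /UV.
Qed.

Lemma inner0 : inner set0 = 0%E.
Proof.
apply/eqP; rewrite eq_le inner_ge0 andbT.
apply: ge_ereal_sup => _ [f [cf f01 fU] <-]; rewrite lee_fin.
apply: (state_le_cst sI) => // x.
by case: (eqVneq (f x) 0) => [->//|/fU].
Qed.

Lemma outer_open U : open U -> outer U = inner U.
Proof.
move=> oU; apply/eqP; rewrite eq_le; apply/andP; split.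
  by apply: ereal_inf_lbound; exists U => //; split.
by apply: le_ereal_inf_tmp => _ [V [oV UV] <-]; exact: le_inner.
Qed.

Lemma outer_ge0 A : (0 <= outer A)%E.
Proof. by apply: le_ereal_inf_tmp => _ [U _ <-]; exact: inner_ge0. Qed.

Lemma outer_le1 A : (outer A <= 1)%E.
Proof.
apply: (@le_trans _ _ (inner setT)); last exact: inner_le1.
by apply: ereal_inf_lbound; exists setT => //; split => //; exact: openT.
Qed.

Lemma outer0 : outer set0 = 0%E.
Proof. by rewrite outer_open ?inner0//; exact: open0. Qed.

(** Up to e, a function below the union is dominated by a finite sum of functions below the [U i]:
    the ramps [v n i] increase with n to the indicator of [U i], and [Dini_le] makes the comparison
    uniform. *)
Lemma inner_bigcup (U : nat -> set X) : (forall i, open (U i)) ->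
  (inner (\bigcup_i U i) <= \sum_(i <oo) inner (U i))%E.
Proof.
move=> oU; apply: ge_ereal_sup => _ [f [cf f01 fU] <-].
apply/lee_addgt0Pr => e e0.
pose v n i x := Num.min 1 (n%:R * tdist (~` U i) x) : R.
pose u n x := \sum_(i < n) v n i x.
have cv n i : continuous (v n i).
  apply: cont_min; first exact: contC.
  by apply: contM; [exact: contC|exact: tdist_continuous].
have v_ge0 n i x : 0 <= v n i x.
  by rewrite le_min ler01 mulr_ge0// tdist_ge0.
have [] := @Dini_le _ _ f u e cX e0 cf.
- by move=> n; exact: cont_sum.
- move=> m n x mn; rewrite /u -!(big_mkord xpredT (fun i => v _ i x)).
  rewrite (big_cat_nat (leq0n m) mn)/= -[leLHS]addr0 lerD ?sumr_ge0//.
  apply: ler_sum => i _; rewrite /v le_min ge_min lexx/= ge_min.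
  by apply/orP; right; rewrite ler_wpM2r ?tdist_ge0// ler_nat.
- move=> x; have [fx0|] := eqVneq (f x) 0.
    by exists 0%N; rewrite fx0 /u big_ord0 add0r.
  move/fU => [i _]; rewrite (open_tdist_gt0 (oU i)) => d0.
  (* The index must exceed i, so that the i-th ramp occurs in the sum, and the inverse distance, so
     that this ramp has reached 1 at x. *)
  pose n := maxn i.+1 (Num.truncn (tdist (~` U i) x)^-1).+1.
  exists n; apply: (@le_lt_trans _ _ 1); first by case/andP: (f01 x).
  apply: (@le_lt_trans _ _ (u n x)); last by rewrite ltrDl.
  have ltin : (i < n)%N by rewrite leq_max leqnn.
  rewrite /u (bigD1 (Ordinal ltin))//= -[leLHS]addr0 lerD ?sumr_ge0//.
  rewrite /v le_min lexx/= -ler_pdivrMr// div1r.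
  apply: (le_trans (ltW (truncnS_gt _))).
  by rewrite ler_nat leq_max leqnn orbT.
move=> n fn; apply: (@le_trans _ _ (\sum_(i < n) (I (v n i))%:E + e%:E)%E).
  rewrite sumEFin -EFinD lee_fin -(state_sum sI)// -[e in leRHS](state_cst sI).
  rewrite -(stateD sI); [|exact: cont_sum|exact: contC].
  apply: (state_le sI) => //.
    by apply: contD; [exact: cont_sum|exact: contC].
  by move=> x; exact/ltW/fn.
rewrite leeD2r//.
apply: (@le_trans _ _ (\sum_(i < n) inner (U i))%E).
  apply: lee_sum => i _; apply: inner_ub; split => //.
    by move=> x; rewrite v_ge0 /v ge_min lexx.
  move=> x vx; apply/(open_tdist_gt0 (oU i)).
  rewrite lt_neqAle tdist_ge0 andbT eq_sym; apply: contraNneq vx => d0.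
  by rewrite /v d0 mulr0; apply/eqP/min_idPr.
rewrite -(big_mkord xpredT (fun i => inner (U i))).
by apply: nneseries_lim_ge => *; exact: inner_ge0.
Qed.

Lemma outer_sigma_subadditive A (F : nat -> set X) : subset_sigma_subadditive outer A F.
Proof.
move=> AF; apply/lee_addgt0Pr => e e0.
apply: le_trans; last first.
  by apply: epsilon_trick; [move=> n; exact: outer_ge0|exact: ltW].
have H n : exists U, [/\ open U, F n `<=` U &
    (inner U <= outer (F n) + (e / (2 ^ n.+1)%:R)%:E)%E].
  have fo : outer (F n) \is a fin_num.
    by rewrite ge0_fin_numE ?outer_ge0// (le_lt_trans (outer_le1 _)) ?ltry.
  have en : 0 < e / (2 ^ n.+1)%:R by rewrite divr_gt0// ltr0n expn_gt0.
  have [_ [U [oU FU] <-] /ltW] := lb_ereal_inf_adherent en fo.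
  by exists U.
have [U HU] := choice H.
apply: (@le_trans _ _ (inner (\bigcup_i U i))).
  rewrite -outer_open; last by apply: bigcup_open => i _; case: (HU i).
  apply: le_ereal_inf => _ [V [oV UV] <-]; exists V => //; split => //.
  apply: subset_trans UV; apply: (subset_trans AF).
  by apply: subset_bigcup => i _; case: (HU i).
apply: (le_trans (inner_bigcup (fun i => let: And3 oU _ _ := HU i in oU))).
by apply: lee_nneseries => [i _ _|i _]; [exact: inner_ge0|case: (HU i)].
Qed.

HB.instance Definition _ := isSubsetOuterMeasure.Build R X outer
  outer0 outer_ge0 outer_sigma_subadditive.

Lemma le_outer A B : A `<=` B -> (outer A <= outer B)%E.
Proof. exact: le_outer_measure. Qed.

(** By outer regularity it suffices to split an open [V]. A function below [V] is assembled from one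
    below the part in [U] and one below an open set containing the rest. *)
Lemma open_caratheodory U : open U -> caratheodory_measurable outer U.
Proof.
move=> oU; apply: le_caratheodory_measurable => A.
apply: le_ereal_inf_tmp => _ [V [oV AV] <-].
apply: (@le_trans _ _ (outer (V `&` U) + outer (V `&` ~` U))%E).
  by apply: leeD; apply: le_outer; exact: setSI.
rewrite [X in (X + _)%E]outer_open; last exact: openI.
have fo : outer (V `&` ~` U) \is a fin_num.
  by rewrite ge0_fin_numE ?outer_ge0// (le_lt_trans (outer_le1 _)) ?ltry.
rewrite -leeBrDr//; apply: ge_ereal_sup => _ [f [cf f01 fU] <-].
rewrite leeBrDr//; apply/lee_addgt0Pr => e e0.
(* [h] lives on {f > e} and any [k] below [W] on {f < e}, so [h + k] is again below [V], while
   replacing f by [h] costs at most e. Since f vanishes off [U], [W] contains [V] minus [U]. *)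
pose h x := Num.max (f x - e) 0.
pose W := V `&` ~` [set x | e <= f x].
have ch : continuous h.
  by apply: cont_max; [apply: contB => //; exact: contC|exact: contC].
have oW : open W by apply: openI => //; exact/closed_openC/closed_ge_fun.
have : (outer (V `&` ~` U) <= inner W)%E.
  rewrite -(outer_open oW); apply: le_outer => x [Vx Ux]; split => //= ef.
  apply: Ux; have [] // := fU x.
  by rewrite gt_eqF// (lt_le_trans e0).
move=> /(leeD2l (I f)%:E) /le_trans; apply.
have fI : (I f)%:E \is a fin_num by [].
rewrite -leeBrDl//; apply: ge_ereal_sup => _ [k [ck k01 kW] <-].
rewrite leeBrDl// -EFinD.
have If : I f <= I h + e.
  rewrite -[e in leRHS](state_cst sI) -(stateD sI)//; last exact: contC.
  apply: (state_le sI) => //; first by apply: contD => //; exact: contC.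
  by move=> x; rewrite -lerBlDr le_max lexx.
apply: (@le_trans _ _ ((I (fun x => h x + k x))%:E + e%:E)%E).
  by rewrite -EFinD lee_fin (stateD sI)//; lra.
rewrite leeD2r//; apply: inner_ub; split; first exact: contD.
- move=> x; have /andP[f0 f1] := f01 x; have /andP[k0 k1] := k01 x.
  rewrite addr_ge0 ?le_max ?lexx ?orbT//=.
  have [->|/kW [_ /= /negP]] := eqVneq (k x) 0.
    by rewrite addr0 ge_max ler01 andbT; lra.
  by rewrite -ltNge => fe; rewrite /h (max_idPr _) ?add0r//; lra.
- move=> x; have [->|/kW [//]] := eqVneq (k x) 0.
  rewrite addr0 /h; have [//|fe _] := leP (f x - e) 0; first by rewrite eqxx.
  by have [] // := fU x; rewrite gt_eqF//; lra.
Qed.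

Lemma Borel_caratheodory (A : set (Borel X)) : measurable A ->
  caratheodory_measurable outer (A : set X).
Proof.
suff H : <<s @open X >> `<=` outer.-cara.-measurable by exact: H.
apply: smallest_sub; last by move=> U; exact: open_caratheodory.
split => //; [by move=> U mU; rewrite setTD; exact: measurableC |
              by move=> u_ mu_; exact: bigcupT_measurable].
Qed.

Definition riesz_measure (A : set (Borel X)) : \bar R := outer A.

Lemma riesz_measure_sigma_additive : semi_sigma_additive riesz_measure.
Proof.
move=> F mF tF mUF; rewrite /riesz_measure.
apply: caratheodory_measure_sigma_additive => //; last exact: Borel_caratheodory.
by move=> i; exact: (Borel_caratheodory (mF i)).
Qed.

HB.instance Definition _ := isMeasure.Build _ _ _ riesz_measure
  outer0 outer_ge0 riesz_measure_sigma_additive.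

Lemma riesz_measure_setT : riesz_measure setT = 1%E.
Proof.
rewrite /riesz_measure outer_open; last exact: openT.
apply/eqP; rewrite eq_le inner_le1/=.
have <- : (I (fun=> 1))%:E = 1%E by rewrite (state1 sI).
apply: inner_ub.
by split => //; [exact: contC|move=> x; rewrite ler01 lexx].
Qed.

HB.instance Definition _ := Measure_isProbability.Build _ _ _ riesz_measure
  riesz_measure_setT.

(** Layer-cake decomposition: the part of n f between the heights j and j + 1. *)
Definition slice (n j : nat) f x : R := Num.min (Num.max (n%:R * f x - j%:R) 0) 1.

Lemma sum_slice (t : R) k : 0 <= t ->
  \sum_(j < k) Num.min (Num.max (t - j%:R) 0) 1 = Num.min t k%:R.
Proof.
move=> t0; elim: k => [|k IH]; first by rewrite big_ord0 (min_idPr t0).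
rewrite big_ord_recr/= IH -natr1.
by case: (leP t k%:R) => ?; case: (leP (t - k%:R) 0) => ?;
  case: (leP _ 1) => ?; case: (leP t (k%:R + 1)) => ?; lra.
Qed.

(* With [g_j = slice n j f], one has [g_(j+1) <= 1_{n f > j+1} <= g_j], hence
   [I g_(j+1) <= mu {n f > j+1} <= tau mu g_j]; sum over [j]. *)
Lemma riesz_le01 f : continuous f -> (forall x, 0 <= f x <= 1) ->
  I f <= tau riesz_measure f.
Proof.
move=> cf f01; have sT := tau_state cX riesz_measure.
have cs n j : continuous (slice n j f).
  apply: cont_min; last exact: contC.
  apply: cont_max; last exact: contC.
  by apply: contB; [apply: contM => //; exact: contC|exact: contC].
have s_ge0 n j x : 0 <= slice n j f x by rewrite le_min ler01 le_max lexx orbT.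
have s_le1 n j x : slice n j f x <= 1 by rewrite ge_min lexx orbT.
have sums n x : n%:R * f x = \sum_(j < n) slice n j f x.
  have /andP[f0 f1] := f01 x.
  rewrite sum_slice ?mulr_ge0// (min_idPl _)//.
  by rewrite -[leRHS]mulr1 ler_wpM2l.
have step n j : I (slice n j.+1 f) <= tau riesz_measure (slice n j f).
  pose U := [set x | j.+1%:R < n%:R * f x].
  have oU : open U by apply: open_gt_fun; apply: contM => //; exact: contC.
  rewrite -lee_fin; apply: (@le_trans _ _ (riesz_measure U)).
    rewrite /riesz_measure outer_open//; apply: inner_ub.
    split => // [x|x]; first by rewrite s_ge0 s_le1.
    rewrite /slice /U /=; case: (leP (_ - _) 0) => [_|]; last by rewrite subr_gt0.
    by rewrite (min_idPl _) ?eqxx.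
  apply: le_mu_tau => //; first exact: open_Borel.
  move=> x; rewrite /U /= -natr1 => Ux.
  by rewrite /slice le_min lexx andbT le_max; apply/orP; left; lra.
(* Comparing the layers with a shift by one leaves the bottom layer on the left, which contributes
   at most 1, and discards the top layer on the right. The error is negligible after division by n +
   1. *)
have main n : n.+1%:R * I f <= 1 + n.+1%:R * tau riesz_measure f.
  rewrite -(stateZ sI)// -(stateZ sT)//.
  have -> : (fun x => n.+1%:R * f x) = (fun x => \sum_(j < n.+1) slice n.+1 j f x).
    by apply/funext.
  rewrite (state_sum sI (F := fun j => slice n.+1 j f))//.
  rewrite (state_sum sT (F := fun j => slice n.+1 j f))//.
  rewrite big_ord_recl big_ord_recr/= addrA.
  rewrite -[leLHS]addr0 lerD//; last by apply: (state_ge0 sT).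
  apply: lerD; first exact: (state_le_cst sI).
  by apply: ler_sum => i _; exact: step.
rewrite leNgt; apply/negP; rewrite -subr_gt0 => d0.
set d := I f - _ in d0.
have := main (Num.truncn d^-1); have := truncnS_gt d^-1.
set m := _.+1%:R => md; have m0 : 0 < m by rewrite ltr0n.
rewrite -lerBlDr -mulrBr -/d; apply/negP; rewrite -ltNge.
by rewrite -ltr_pdivrMr// div1r.
Qed.

(** States commute with the affine map t -> t / (2M) + 1/2, which sends [-M, M] into [0, 1]. *)
Lemma riesz_le f : continuous f -> I f <= tau riesz_measure f.
Proof.
move=> cf; have [M M0 fM] := compact_bounded_fun cX cf.
have sT := tau_state cX riesz_measure.
have := @riesz_le01 (fun x => (2 * M)^-1 * f x + 2^-1).
have chf : continuous (fun x => (2 * M)^-1 * f x) by apply: contM => //; exact: contC.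
have i0 : 0 < (2 * M)^-1 by rewrite invr_gt0; lra.
rewrite (stateD sI)//; last exact: contC.
rewrite (stateD sT)//; last exact: contC.
rewrite !(state_cst sI) !(state_cst sT) (stateZ sI)// (stateZ sT)// lerD2r.
rewrite ler_pM2l//; apply; first by apply: contD => //; exact: contC.
move=> x; have := fM x; rewrite ler_norml => /andP[fl fu].
have -> : 2^-1 = (2 * M)^-1 * M :> R by field; rewrite gt_eqF.
rewrite -mulrDr mulr_ge0 ?(ltW i0)//=; last lra.
by rewrite mulrC ler_pdivrMr; lra.
Qed.

Lemma riesz_representation : exists mu : bprob X,
  forall f, continuous f -> tau mu f = I f.
Proof.
exists riesz_measure => f cf; apply/eqP; rewrite eq_le riesz_le// andbT.
have sT := tau_state cX riesz_measure.
(* The inequality for -f is the reverse inequality for f. *)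
have := riesz_le (contN cf).
have N J : is_state J -> J (fun x => - f x) = - J f.
  move=> sJ; rewrite -mulN1r -(stateZ sJ)//.
  by congr J; apply/funext => x; rewrite mulN1r.
by rewrite !N// lerN2.
Qed.

End Riesz.

(** * Complex sequences and ultralimits *)

Section Complex.
Context {R : realType}.
Implicit Types z w : R[i].

Lemma normr_sqr (x : R) : `|x| ^+ 2 = x ^+ 2.
Proof. by rewrite real_normK ?num_real. Qed.

Lemma ReB z w : complex.Re (z - w) = complex.Re z - complex.Re w.
Proof. by case: z; case: w. Qed.

Lemma ImB z w : complex.Im (z - w) = complex.Im z - complex.Im w.
Proof. by case: z; case: w. Qed.

Lemma ReM z w : complex.Re (z * w) =
  complex.Re z * complex.Re w - complex.Im z * complex.Im w.
Proof. by case: z; case: w. Qed.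

Lemma ImM z w : complex.Im (z * w) =
  complex.Re z * complex.Im w + complex.Im z * complex.Re w.
Proof. by case: z; case: w. Qed.

Lemma abs2_ge0 z : 0 <= abs2 z.
Proof. by rewrite addr_ge0 ?sqr_ge0. Qed.

Lemma abs2M z w : abs2 (z * w) = abs2 z * abs2 w.
Proof. by rewrite /abs2 ReM ImM; ring. Qed.

Lemma abs2B_le z w : abs2 (z - w) <= 2 * (abs2 z + abs2 w).
Proof.
rewrite /abs2 ReB ImB; have := sqr_ge0 (complex.Re z + complex.Re w).
have := sqr_ge0 (complex.Im z + complex.Im w); nra.
Qed.

Lemma sqr_cabs z : cabs z ^+ 2 = abs2 z.
Proof. by rewrite /cabs sqr_sqrtr// abs2_ge0. Qed.

Lemma cabs_ge0 z : 0 <= cabs z.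
Proof. exact: sqrtr_ge0. Qed.

Lemma abs2_conj_sub z : abs2 (z - conjc z) = (2 * complex.Im z) ^+ 2.
Proof. by case: z => a b; rewrite /abs2 /=; ring. Qed.

End Complex.

Section SupLe.
Context {R : realType}.

(** The supremum of the empty set is 0, whence the sign condition on c; this case occurs when
    [Delta] is empty. *)
Lemma sup_le_nneg (A : set R) c : 0 <= c -> (forall x, A x -> x <= c) -> sup A <= c.
Proof.
move=> c0 Ac; have [->|/set0P A0] := eqVneq A set0; first by rewrite sup0.
exact: ge_sup.
Qed.

(** If [A] is empty or unbounded, [sup A] is the default value 0, which satisfies the bound. *)
Lemma sup_ge0_nneg (A : set R) : (forall x, A x -> 0 <= x) -> 0 <= sup A.
Proof.
move=> A0; have [hA|/sup_out ->//] := pselect (has_sup A).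
have [[x Ax] ubA] := hA.
exact: le_trans (A0 _ Ax) (ub_le_sup ubA Ax).
Qed.

End SupLe.

Section Sequences.
Context {R : realType} {X : pseudoPMetricType R} (cX : compact [set: X]).
Implicit Types (mu : bprob X) (g h : X -> R[i]) (a b : cseq X) (Delta : set (bprob X)).

Lemma ccont_abs2 g : ccontinuous g -> continuous (fun x => abs2 (g x)).
Proof. by move=> [cr ci]; apply: contD; exact: contX. Qed.

Lemma ccontB g h : ccontinuous g -> ccontinuous h -> ccontinuous (fun x => g x - h x).
Proof.
move=> [gr gi] [hr hi]; split.
  by under eq_fun do rewrite ReB; exact: contB.
by under eq_fun do rewrite ImB; exact: contB.
Qed.

Lemma ccont_real (f : X -> R) : continuous f -> ccontinuous (fun x => (f x)%:C%C).
Proof. by move=> cf; split => //=; exact: contC. Qed.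

Lemma linfty_abs2 a : linfty a -> exists M, forall n x, abs2 (a n x) <= M.
Proof.
move=> [_ [M aM]]; exists (M ^+ 2) => n x; rewrite -sqr_cabs.
by rewrite lerXn2r ?nnegrE ?cabs_ge0//; exact: le_trans (cabs_ge0 _) (aM n x).
Qed.

Lemma linfty_bounded a M : (forall n, ccontinuous (a n)) ->
  (forall n x, abs2 (a n x) <= M) -> linfty a.
Proof.
move=> ca aM; split => //; exists (Num.sqrt M) => n x.
by rewrite /cabs ler_wsqrtr.
Qed.

Lemma linfty_sub a b : linfty a -> linfty b -> linfty (csub a b).
Proof.
move=> la lb; have [M aM] := linfty_abs2 la; have [N bN] := linfty_abs2 lb.
apply: (@linfty_bounded _ (2 * (M + N))) => [n|n x].
  by apply: ccontB; [exact: la.1|exact: lb.1].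
by apply: (le_trans (abs2B_le _ _)); rewrite ler_pM2l// lerD.
Qed.

Lemma linfty_const (f : X -> R) : continuous f -> linfty (cconst f).
Proof.
move=> cf; have [M M0 fM] := compact_bounded_fun cX cf.
apply: (@linfty_bounded _ (M ^+ 2)) => [n|n x]; first exact: ccont_real.
by rewrite /abs2 /= expr0n addr0 -real_normK ?num_real// lerXn2r ?nnegrE// ltW.
Qed.

Lemma tau_abs2_ge0 mu g : ccontinuous g -> 0 <= tau mu (fun x => abs2 (g x)).
Proof.
move=> cg; apply: (state_ge0 (tau_state cX mu)); first exact: ccont_abs2.
by move=> x; exact: abs2_ge0.
Qed.

Lemma sup_tau2_ge0 Delta g : ccontinuous g -> 0 <= sup_tau2 Delta g.
Proof. by move=> cg; apply: sup_ge0_nneg => _ [mu _ <-]; exact: tau_abs2_ge0. Qed.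

Lemma tau_abs2_le mu g M : ccontinuous g -> (forall x, abs2 (g x) <= M) ->
  tau mu (fun x => abs2 (g x)) <= M.
Proof.
by move=> cg gM; apply: (state_le_cst (tau_state cX mu)) => //; exact: ccont_abs2.
Qed.

Lemma sup_tau2_le Delta g c : 0 <= c ->
  (forall mu, Delta mu -> tau mu (fun x => abs2 (g x)) <= c) -> sup_tau2 Delta g <= c.
Proof. by move=> c0 H; apply: sup_le_nneg => // _ [mu Dmu <-]; exact: H. Qed.

Lemma tau_le_sup_tau2 Delta mu g : ccontinuous g -> Delta mu ->
  tau mu (fun x => abs2 (g x)) <= sup_tau2 Delta g.
Proof.
move=> cg Dmu; apply: ub_le_sup; last by exists mu.
have [M _ gM] := compact_bounded_fun cX (ccont_abs2 cg).
exists M => _ [nu _ <-]; apply: tau_abs2_le => // x.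
exact: le_trans (ler_norm _) (gM x).
Qed.

(** Compactness of [-M, M] gives a cluster point along [omega], and an ultrafilter converges to each
    of its cluster points. *)
Lemma is_ulim_exists omega (s : nat -> R) M : UltraFilter omega ->
  (forall n, `|s n| <= M) -> exists L, is_ulim omega s L.
Proof.
move=> Uo sM; have Po : ProperFilter omega by exact: ultra_proper.
have [|L [_ sL]] := @segment_compact R (- M) M (s @ omega) _.
  apply: (@filterS _ omega _ setT); last exact: filterT.
  by move=> n _ /=; have := sM n; rewrite in_itv /= ler_norml.
exists L => e e0.
have [//|oN] := in_ultra_setVsetC [set n | `|s n - L| < e] Uo; exfalso.
have [y []] := sL (~` [set y | `|y - L| < e]) _ oN (nbhsx_ballx L e e0).
by move=> ny; rewrite /ball /= distrC.
Qed.

(** Boundedness provides an ultralimit, so [ulim] picks a true limit and not its default value. *)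
Lemma is_ulim_norm2w omega Delta a : UltraFilter omega -> linfty a ->
  is_ulim omega (fun n => sup_tau2 Delta (a n)) (norm2w omega Delta a).
Proof.
move=> Uo la; apply: xgetPex; have [M aM] := linfty_abs2 la.
apply: (@is_ulim_exists omega _ `|M|) => // n.
rewrite ger0_norm ?sup_tau2_ge0//; last exact: la.1.
apply: sup_tau2_le => // mu _; apply: tau_abs2_le; first exact: la.1.
by move=> x; exact: le_trans (aM n x) (ler_norm _).
Qed.

Lemma free_ultra_ge omega : free_ultrafilter omega -> forall N, omega [set n | (N <= n)%N].
Proof.
move=> [Uo fo] N; have [//|oN] := in_ultra_setVsetC [set n | (N <= n)%N] Uo.
exfalso; apply: (fo _ _ oN).
apply: (@sub_finite_set _ _ `I_N); last exact: finite_II.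
by move=> n /= /negP; rewrite -ltnNge.
Qed.

End Sequences.

(** * From invertible approximation to small boundaries *)

Section UniformLimit.
Context {R : realType} {T : topologicalType}.

Lemma unif_approx_continuous (g : T -> R) :
  (forall e, 0 < e -> exists2 h : T -> R, continuous h & forall x, `|g x - h x| <= e) ->
  continuous g.
Proof.
move=> H x; apply/cvgrPdist_lt => e e0.
have e4 : 0 < e / 4 by rewrite divr_gt0.
have [h ch gh] := H _ e4.
have := ch x => /cvgrPdist_lt /(_ _ e4); apply: filterS => y hxy.
have := gh x; have := gh y; move: hxy.
rewrite ltr_norml !ler_norml ltr_norml; lra.
Qed.

End UniformLimit.

(** * Approximation by functions with small zero sets *)

Section SmallZeroSets.
Context {R : realType} {X : pseudoPMetricType R} (cX : compact [set: X]).
Context {omega : set_system nat} (homega : free_ultrafilter omega).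
Context {Delta : set (bprob X)}.
Implicit Types (f g : X -> R).

(** A tent over the zero set of g: for d > 0, a continuous substitute for the indicator of {|g| <
    d}. *)
Definition hat (d : R) g x : R := Num.max 0 (1 - `|g x| / d).

Lemma hat_continuous d g : continuous g -> continuous (hat d g).
Proof.
move=> cg; apply: cont_max; first exact: contC.
apply: contB; first exact: contC.
by apply: contM; [exact: cont_norm|exact: contC].
Qed.

Lemma hat_ge0 d g x : 0 <= hat d g x.
Proof. by rewrite le_max lexx. Qed.

Lemma hat_le1 d g x : 0 < d -> hat d g x <= 1.
Proof. by move=> d0; rewrite ge_max ler01 gerBl divr_ge0// ltW. Qed.

Lemma hat_eq0 d g x : 0 < d -> d <= `|g x| -> hat d g x = 0.
Proof. by move=> d0 dg; apply/max_idPl; rewrite subr_le0 ler_pdivlMr// mul1r. Qed.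

Lemma clip_dist (a eta t : R) : 0 < eta ->
  `|a - Num.max (a - eta) (Num.min (a + eta) t)| <= eta.
Proof.
move=> eta0; rewrite ler_norml.
by case: (leP (a + eta)) => ?; case: (leP (a - eta)) => ?; lra.
Qed.

(* If [bc] is close to [1] and [b] is nearly real, then [Re b] is small only on a set
   of small measure. Clipping [Re b] to [[f - eta, f + eta]] turns closeness in 2-norm
   into uniform closeness, at the cost of the Chebyshev term [abs2 (f - b)]. *)
Lemma hat_clip_le (eta M d f v w : R) (b c : R[i]) :
  0 < eta -> 0 < M -> abs2 c <= M ^+ 2 -> d = (4 * M)^-1 ->
  v = Num.max (f - eta) (Num.min (f + eta) (complex.Re b)) ->
  0 <= w <= 1 -> (d <= `|v| -> w = 0) ->
  w <= eta ^- 2 * abs2 (f%:C%C - b) + 4 * abs2 (b * c - 1) + d ^- 2 * abs2 (b - conjc b).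
Proof.
move=> eta0 M0 cM dE vE /andP[w0 w1] wv.
have d0 : 0 < d by rewrite dE invr_gt0 mulr_gt0.
have t1 : 0 <= eta ^- 2 * abs2 (f%:C%C - b) by rewrite mulr_ge0 ?abs2_ge0// invr_ge0 sqr_ge0.
have t2 : 0 <= 4 * abs2 (b * c - 1) by rewrite mulr_ge0 ?abs2_ge0.
have t3 : 0 <= d ^- 2 * abs2 (b - conjc b) by rewrite mulr_ge0 ?abs2_ge0// invr_ge0 sqr_ge0.
have [dv|vd] := leP d `|v|; first by rewrite wv// !addr_ge0.
apply: (le_trans w1).
(* In each remaining case one summand is at least 1: b is far from f, or its imaginary part is
   large, or |b| is so small that bc stays away from 1. *)
have [near|far] := leP `|complex.Re b - f| eta; last first.
  have : 1 <= eta ^- 2 * abs2 (f%:C%C - b).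
    rewrite mulrC ler_pdivlMr ?exprn_gt0// mul1r /abs2 ReB ImB /=.
    rewrite -[leLHS]addr0 lerD ?sqr_ge0// -(normr_sqr (f - _)) distrC.
    by rewrite lerXn2r ?nnegrE ?(ltW eta0)//= ltW.
  lra.
have vb : v = complex.Re b.
  move: near; rewrite ler_norml => /andP[n1 n2].
  by rewrite vE (min_idPr _) ?(max_idPr _)//; lra.
rewrite vb in vd.
have [Im_big|Im_small] := leP d `|complex.Im b|.
  have : 1 <= d ^- 2 * abs2 (b - conjc b).
    rewrite mulrC ler_pdivlMr ?exprn_gt0// mul1r abs2_conj_sub exprMn.
    rewrite -(normr_sqr (complex.Im b)).
    have : d ^+ 2 <= `|complex.Im b| ^+ 2 by rewrite lerXn2r ?nnegrE ?(ltW d0).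
    have := sqr_ge0 `|complex.Im b|; lra.
  lra.
have b_small : abs2 b <= 2 * d ^+ 2.
  rewrite /abs2 -(normr_sqr (complex.Re b)) -(normr_sqr (complex.Im b)).
  have H (y : R) : `|y| < d -> `|y| ^+ 2 <= d ^+ 2.
    by move=> yd; rewrite lerXn2r ?nnegrE ?(ltW d0) ?(ltW yd).
  have := H _ vd; have := H _ Im_small; lra.
(* The choice d = 1/(4M) gives |bc|^2 <= 2 d^2 M^2 = 1/8, hence Re (bc) <= 1/2 and |bc - 1|^2 >=
   1/4, which the coefficient 4 turns into 1. *)
have bc_small : abs2 (b * c) <= 2^-1 ^+ 2.
  rewrite abs2M; apply: (@le_trans _ _ (2 * d ^+ 2 * M ^+ 2)).
    by apply: ler_pM => //; exact: abs2_ge0.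
  rewrite -mulrA -exprMn (_ : d * M = 4^-1); first by lra.
  by rewrite dE; field; rewrite gt_eqF.
have : 4^-1 <= abs2 (b * c - 1).
  have re : complex.Re (b * c) <= 2^-1.
    apply: (le_trans (ler_norm _)); rewrite -(@ler_pXn2r _ 2)// ?nnegrE//.
    apply: le_trans bc_small; rewrite real_normK ?num_real// /abs2 lerDl sqr_ge0 //.
  rewrite /abs2 ReB ImB /= subr0; have := sqr_ge0 (complex.Im (b * c)).
  by nra.
lra.
Qed.

Definition approximable2 := forall f, continuous f -> forall e : R, 0 < e ->
  exists b : cseq X, sa_invertible omega Delta b /\
    norm2w omega Delta (csub (cconst f) b) < e.

Lemma approx_small_hat (H : approximable2) f eta e :
  continuous f -> 0 < eta -> 0 < e ->
  exists g d, [/\ continuous g, 0 < d, forall x, `|f x - g x| <= eta &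
    forall mu, Delta mu -> tau mu (hat d g) <= e].
Proof.
move=> cf eta0 e0; have [Uo _] := homega.
have Po : ProperFilter omega by exact: ultra_proper.
(* The tolerances eta^2 e/3, e/12 and d^2 e/3 cancel the coefficients eta^-2, 4 and d^-2 of
   [hat_clip_le], so each summand contributes at most e/3. No root appears because [norm2w] is a
   limit of squared 2-norms. *)
have e1 : 0 < eta ^+ 2 * (e / 3) by rewrite mulr_gt0 ?exprn_gt0// divr_gt0.
have [b [[[lb _] Jsa [c [[lc _] Jbc _]] fb]]] := H f cf _ e1.
have [M0 [cc cM0]] : exists M0, (forall n, ccontinuous (c n)) /\
    forall n x, cabs (c n x) <= M0.
  by have [cc [M0 cM0]] := lc; exists M0.
pose M := Num.max 1 M0; have Mgt0 : 0 < M by rewrite lt_max ltr01.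
have cM n x : abs2 (c n x) <= M ^+ 2.
  rewrite -sqr_cabs lerXn2r ?nnegrE ?cabs_ge0 ?(ltW Mgt0)//.
  by rewrite le_max cM0 orbT.
pose d := (4 * M)^-1; have d0 : 0 < d by rewrite invr_gt0 mulr_gt0.
have lfb := linfty_sub (linfty_const cX cf) lb.
have U1 := is_ulim_norm2w cX Delta Uo lfb.
have U1' : omega [set n | sup_tau2 Delta (csub (cconst f) b n) < eta ^+ 2 * (e / 3)].
  have := U1 _ (_ : 0 < eta ^+ 2 * (e / 3) - norm2w omega Delta (csub (cconst f) b)).
  rewrite subr_gt0 => /(_ fb); apply: filterS => n /=.
  by rewrite ltr_norml => /andP[_]; lra.
have e12 : 0 < e / 12 by rewrite divr_gt0.
have e3 : 0 < d ^+ 2 * (e / 3) by rewrite mulr_gt0 ?exprn_gt0// divr_gt0.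
have Fo : Filter omega by by case: Po.
have [n /= [s1 [s2 s3]]] :=
  filter_ex (filterI U1' (filterI (Jbc.2 _ e12) (Jsa.2 _ e3))).
rewrite subr0 in s2; rewrite subr0 in s3.
have {}s2 := le_lt_trans (ler_norm _) s2; have {}s3 := le_lt_trans (ler_norm _) s3.
have cb := lb.1 n.
pose g x := Num.max (f x - eta) (Num.min (f x + eta) (complex.Re (b n x))).
have cg : continuous g.
  apply: cont_max; first by apply: contB => //; exact: contC.
  by apply: cont_min; [apply: contD => //; exact: contC|exact: cb.1].
exists g, d; split => //.
  by move=> x; exact: clip_dist.
move=> mu Dmu; have sT := tau_state cX mu.
have c1 := ccont_abs2 (lfb.1 n); have c2 := ccont_abs2 (Jbc.1.1 n).
have c3 := ccont_abs2 (Jsa.1.1 n).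
have cZ (k : R) (h : X -> R) : continuous h -> continuous (fun x => k * h x).
  by move=> ch; apply: contM => //; exact: contC.
apply: (@le_trans _ _ (tau mu (fun x => eta ^- 2 * abs2 (csub (cconst f) b n x) +
    4 * abs2 (csub (cmul b c) (cone (X:=X)) n x) + d ^- 2 * abs2 (csub b (cstar b) n x)))).
  apply: (state_le sT); first exact: hat_continuous.
    by apply: contD; [apply: contD|]; exact: cZ.
  move=> x; apply: (@hat_clip_le eta M d (f x) (g x)) => //.
    by rewrite hat_ge0 hat_le1.
  exact: hat_eq0.
rewrite (stateD sT); [|by apply: contD; exact: cZ|exact: cZ].
rewrite (stateD sT); [|exact: cZ|exact: cZ].
rewrite !(stateZ sT)//.
have t1 := le_lt_trans (tau_le_sup_tau2 cX (lfb.1 n) Dmu) s1.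
have t2 := le_lt_trans (tau_le_sup_tau2 cX (Jbc.1.1 n) Dmu) s2.
have t3 := le_lt_trans (tau_le_sup_tau2 cX (Jsa.1.1 n) Dmu) s3.
move: t1 t2 t3; set A1 := tau mu _; set A2 := tau mu _; set A3 := tau mu _ => t1 t2 t3.
have q1 : eta ^- 2 * A1 < e / 3 by rewrite mulrC ltr_pdivrMr ?exprn_gt0// mulrC.
have q3 : d ^- 2 * A3 < e / 3 by rewrite mulrC ltr_pdivrMr ?exprn_gt0// mulrC.
by move: q1 t2 q3; clear; lra.
Qed.

(** Asking for the bound on a whole closed uniform ball lets it pass to the common point of nested
    balls. *)
Definition small_near (e : R) g (r : R) : Prop := forall h : X -> R, continuous h ->
  (forall x, `|h x - g x| <= r) ->
  forall mu, Delta mu -> (mu ([set x | (h x = 0)%R] : set (Borel X)) <= e%:E)%E.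

Lemma closed_zeros g : continuous g -> closed [set x | g x = 0].
Proof.
move=> cg; rewrite (_ : [set _ | _] = [set x | g x <= 0] `&` [set x | 0 <= g x]).
  by apply: closedI; [exact: closed_le_fun|exact: closed_ge_fun].
apply/seteqP; split => x /=; first by move=> ->.
by move=> [g1 g2]; apply/eqP; rewrite eq_le g1 g2.
Qed.

Lemma approx_small_near (H : approximable2) f eta e : continuous f -> 0 < eta -> 0 < e ->
  exists g r, [/\ continuous g, 0 < r, forall x, `|f x - g x| <= eta & small_near e g r].
Proof.
move=> cf eta0 e0; have e2 : 0 < e / 2 by rewrite divr_gt0.
have [g [d [cg d0 fg gd]]] := approx_small_hat H cf eta0 e2.
(* At a zero of h one has |g| <= d/2, so the tent is at least 1/2 there and twice the tent dominates
   the indicator of the zero set. *)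
exists g, (d / 2); split => //; first by rewrite divr_gt0.
move=> h ch hg mu Dmu.
have c2 : continuous (fun x => 2 * hat d g x).
  by apply: contM; [exact: contC|exact: hat_continuous].
apply: (@le_trans _ _ (tau mu (fun x => 2 * hat d g x))%:E).
  apply: le_mu_tau => //.
  - by apply: closed_Borel; exact: closed_zeros.
  - by move=> x; rewrite mulr_ge0// hat_ge0.
  move=> x /= h0; have := hg x; rewrite h0 sub0r normrN => gx.
  have : `|g x| / d <= 2^-1 by rewrite ler_pdivrMr// mulrC.
  have : 1 - `|g x| / d <= hat d g x by rewrite le_max lexx orbT.
  lra.
rewrite lee_fin (stateZ (tau_state cX mu)); last exact: hat_continuous.
have := gd mu Dmu; lra.
Qed.

(* Baire category argument: nested closed balls [B(g_k, r_k)] of C(X), all of whose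
   elements have zero set of measure at most [1/(k+1)]. *)
Lemma approx_null_zeros (H : approximable2) f eta : continuous f -> 0 < eta ->
  exists2 g, continuous g & (forall x, `|f x - g x| <= eta) /\
    forall mu, Delta mu -> mu ([set x | (g x = 0)%R] : set (Borel X)) = 0%E.
Proof.
move=> cf eta0.
pose good (p : (X -> R) * R) := continuous p.1 /\ 0 < p.2.
(* The guard [good p] makes the relation total, so that [choice] applies. *)
pose next (k : nat) (p q : (X -> R) * R) := good p ->
  [/\ good q, q.2 <= p.2 / 2, forall x, `|p.1 x - q.1 x| <= p.2 / 2,
      q.2 <= k.+1%:R^-1 & small_near k.+1%:R^-1 q.1 q.2].
have nextP (kp : nat * ((X -> R) * R)) : exists q, next kp.1 kp.2 q.
  case: kp => k p /=; have [gp|] := pselect (good p); last by exists p.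
  have [cp p0] := gp; have p2 : 0 < p.2 / 2 by rewrite divr_gt0.
  have k0 : 0 < k.+1%:R^-1 :> R by [].
  have [g [r [cg r0 pg sg]]] := approx_small_near H cp p2 k0.
  pose r' := Num.min r (Num.min (p.2 / 2) k.+1%:R^-1).
  exists (g, r') => _; split => /=.
  - by split => //=; rewrite !lt_min r0 p2 k0.
  - by rewrite /r' ge_min (ge_min _ (p.2 / 2)) lexx orbT.
  - by [].
  - by rewrite /r' ge_min (ge_min _ (p.2 / 2)) lexx !orbT.
  - move=> h ch hg; apply: sg => // x; apply: (le_trans (hg x)).
    by rewrite ge_min lexx.
have [F FP] := choice nextP.
pose s := fix s k := if k is k'.+1 then F (k', s k') else (f, eta).
have sP k : good (s k) by elim: k => [|k IH] //=; case: (FP (k, s k) IH).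
have sN k : next k (s k) (s k.+1) := FP (k, s k).
pose g_ k := (s k).1; pose r_ k := (s k).2.
(* Radii at least halve, so a move of at most r_m / 2 is at most r_m - r_(m+1), and these bounds
   telescope. *)
have nest k m x : (k <= m)%N -> `|g_ m x - g_ k x| <= r_ k - r_ m.
  elim: m => [|m IH]; first by rewrite leqn0 => /eqP ->; rewrite !subrr normr0.
  rewrite leq_eqVlt => /predU1P[->|]; first by rewrite !subrr normr0.
  rewrite ltnS => /IH; have [_ h2 h3 _ _] := sN m (sP m).
  have := h3 x; rewrite -/(g_ m) -/(g_ m.+1) -/(r_ m); rewrite -/(r_ m) -/(r_ m.+1) in h2.
  rewrite !ler_norml; lra.
have r_ge0 k : 0 < r_ k by case: (sP k).
(* At each x the intervals [g_k - r_k, g_k + r_k] are nested; the limit is the supremum of their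
   left ends. *)
pose low x := [set g_ k x - r_ k | k in [set: nat]].
have lowub x m : ubound (low x) (g_ m x + r_ m).
  move=> _ [k _ <-]; have := r_ge0 k; have := r_ge0 m.
  have [km|/ltnW mk] := leqP k m.
    by have := nest k m x km; rewrite ler_norml; lra.
  by have := nest m k x mk; rewrite ler_norml; lra.
pose g x := sup (low x).
have gg k x : `|g x - g_ k x| <= r_ k.
  have l1 : g_ k x - r_ k <= g x.
    by apply: ub_le_sup; [exists (g_ 0%N x + r_ 0%N); exact: lowub|exists k].
  have l2 : g x <= g_ k x + r_ k.
    by apply: ge_sup; [exists (g_ 0%N x - r_ 0%N), 0%N|exact: lowub].
  rewrite ler_norml; lra.
have cg : continuous g.
  apply: unif_approx_continuous => e e0.
  pose k := Num.truncn e^-1.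
  exists (g_ k.+1); first by case: (sP k.+1).
  move=> x; apply: (le_trans (gg _ _)); have [_ _ _ h _] := sN k (sP k).
  apply: (le_trans h); rewrite -[leRHS]invrK lef_pV2 ?posrE ?invr_gt0//.
  exact/ltW/truncnS_gt.
exists g => //; split.
  by move=> x; rewrite distrC; exact: (gg 0%N).
move=> mu Dmu; apply/eqP; rewrite eq_le measure_ge0 andbT.
apply/lee_addgt0Pr => e e0; rewrite add0e.
pose k := Num.truncn e^-1.
have [_ _ _ _ h] := sN k (sP k).
apply: (le_trans (h g cg (gg k.+1) mu Dmu)).
rewrite lee_fin -[leRHS]invrK lef_pV2 ?posrE ?invr_gt0//.
exact/ltW/truncnS_gt.
Qed.

Lemma approximable2_small_boundary : approximable2 -> small_boundary_property Delta.
Proof.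
move=> H x U oU Ux; pose t := tdist (~` U).
have tx : 0 < t x by apply/(open_tdist_gt0 oU).
(* f is 1 at x and -1 off [U], so any g within 1/2 of it is positive at x and negative off [U]. *)
pose f y := 2 * Num.min 1 (t y / t x) - 1.
have cf : continuous f.
  apply: contB; last exact: contC.
  apply: contM; first exact: contC.
  apply: cont_min; first exact: contC.
  by apply: contM; [exact: tdist_continuous|exact: contC].
have h0 : 0 < 2^-1 :> R by [].
have [g cg [fg g0]] := approx_null_zeros H cf h0.
have oV : open [set y | 0 < g y] by exact: open_gt_fun.
exists [set y | 0 < g y]; split => //=.
- have := fg x; rewrite /f divff ?gt_eqF// minxx ler_norml; lra.
- move=> y /= gy; apply/(open_tdist_gt0 oU); rewrite lt_neqAle tdist_ge0 andbT eq_sym.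
  apply/eqP => ty; have := fg y; rewrite /f /t ty mul0r (min_idPr _)// ler_norml; lra.
- move=> mu Dmu; apply/eqP; rewrite eq_le measure_ge0 andbT -(g0 mu Dmu).
  apply: le_measure; rewrite ?inE.
  + apply: measurableD; first by apply: closed_Borel; exact: closed_closure.
    by apply: open_Borel; exact: open_interior.
  + by apply: closed_Borel; exact: closed_zeros.
  (* On the boundary of {g > 0} both g >= 0, by closure, and g <= 0 hold. *)
  + rewrite /bdry (iffLR (interior_id _) oV) => y [cy] /= /negP.
    rewrite -leNgt => gy; apply/eqP; rewrite eq_le gy/=.
    have cl : closed [set y | 0 <= g y] by exact: closed_ge_fun.
    have /closure_id clE := cl; suff : [set y | 0 <= g y] y by [].
    rewrite clE; apply: closure_subset cy => z /=; exact: ltW.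
Qed.

End SmallZeroSets.

(** * Weak* compactness *)

Section UltraLimits.
Context {R : realType} {omega : set_system nat} (Po : ProperFilter omega).
Implicit Types s t : nat -> R.

Lemma is_ulimP s L : is_ulim omega s L <-> s @ omega --> L.
Proof.
split=> [sL|/cvgrPdist_lt sL e e0].
  apply/cvgrPdist_lt => e e0; have := sL e e0.
  by apply: filterS => n /=; rewrite distrC.
by have := sL e e0; apply: filterS => n /=; rewrite distrC.
Qed.

Lemma is_ulim_lin a s t L L' : is_ulim omega s L -> is_ulim omega t L' ->
  is_ulim omega (fun n => a * s n + t n) (a * L + L').
Proof.
move=> /is_ulimP sL /is_ulimP tL; apply/is_ulimP.
by apply: cvgD => //; apply: cvgM => //; exact: cvg_cst.
Qed.

Lemma is_ulim_le s t L L' : is_ulim omega s L -> is_ulim omega t L' ->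
  omega [set n | s n <= t n] -> L <= L'.
Proof.
move=> sL tL st; rewrite leNgt; apply/negP => LL.
have e0 : 0 < (L - L') / 2 by rewrite divr_gt0// subr_gt0.
have [n /= [s1 [s2 s3]]] := filter_ex (filterI (sL _ e0) (filterI (tL _ e0) st)).
by move: s1 s2 s3; rewrite !ltr_norml; lra.
Qed.

Lemma is_ulim_cst (a : R) : is_ulim omega (fun=> a) a.
Proof. by apply/is_ulimP; exact: cvg_cst. Qed.

Lemma is_ulim_unique s L L' : is_ulim omega s L -> is_ulim omega s L' -> L = L'.
Proof.
move=> sL sL'; apply/eqP; rewrite eq_le.
have st : omega [set n | s n <= s n] by apply: filterS filterT => n _ /=.
by rewrite (is_ulim_le sL sL' st) (is_ulim_le sL' sL st).
Qed.

End UltraLimits.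

(** * Weak* limits in [Delta] and uniform smallness near null zero sets *)

Section SmallBoundary.
Context {R : realType} {X : pseudoPMetricType R} (cX : compact [set: X]).
Context {omega : set_system nat} (homega : free_ultrafilter omega).
Context {Delta : set (bprob X)} (hDelta : weak_star_closed Delta).
Implicit Types (mu : bprob X) (f g : X -> R) (A W : set X).

(* Banach-Alaoglu for the state space, through ultralimits and Riesz representation. *)
Lemma weak_star_limit (mus : nat -> bprob X) : (forall n, Delta (mus n)) ->
  exists2 mu, Delta mu & forall f, continuous f ->
    is_ulim omega (fun n => tau (mus n) f) (tau mu f).
Proof.
move=> Dmus; have [Uo _] := homega.
have Po : ProperFilter omega by exact: ultra_proper.
have Fo : Filter omega by case: Po.
pose I f := ulim omega (fun n => tau (mus n) f).
have IP f : continuous f -> is_ulim omega (fun n => tau (mus n) f) (I f).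
  move=> cf; apply: xgetPex; have [M _ fM] := compact_bounded_fun cX cf.
  apply: (@is_ulim_exists _ omega _ M) => // n; have sT := tau_state cX (mus n).
  rewrite ler_norml; apply/andP; split.
    by apply: (state_ge_cst sT) => // x; have := fM x; rewrite ler_norml => /andP[].
  by apply: (state_le_cst sT) => // x; exact: le_trans (ler_norm _) (fM x).
have sI : is_state I.
  split=> [a f g cf cg|f cf f0|].
  - apply: (is_ulim_unique Po (IP _ _)).
      by apply: contD => //; apply: contM => //; exact: contC.
    have -> : (fun n => tau (mus n) (fun x => a * f x + g x)) =
        (fun n => a * tau (mus n) f + tau (mus n) g).
      by apply/funext => n; rewrite (stateL (tau_state cX (mus n))).
    by apply: is_ulim_lin; exact: IP.
  - apply: (is_ulim_le Po (is_ulim_cst Po 0) (IP f cf)).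
    by apply: filterS filterT => n _ /=; exact: (state_ge0 (tau_state cX (mus n))).
  - apply: (is_ulim_unique Po (IP _ _)); first exact: contC.
    have -> : (fun n => tau (mus n) (fun=> 1)) = fun=> 1.
      by apply/funext => n; rewrite (state1 (tau_state cX (mus n))).
    exact: is_ulim_cst.
have [mu muI] := riesz_representation cX sI.
exists mu; last by move=> f cf; rewrite muI//; exact: IP.
apply: hDelta => k fs e cfs e0.
(* Finitely many test functions give finitely many members of [omega], whose intersection is
   nonempty. *)
have : omega [set n | forall i, (i < k)%N -> `|tau mu (fs i) - tau (mus n) (fs i)| < e].
  elim: k cfs => [_|k IH cfs]; first by apply: filterS filterT.
  have H1 := IH (fun i ik => cfs i (leqW ik)).
  have H2 := IP _ (cfs k (ltnSn k)) e e0.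
  apply: filterS (filterI H1 H2) => n /= [h1 h2] i.
  rewrite ltnS leq_eqVlt => /predU1P[->|]; last exact: h1.
  by rewrite muI 1?distrC//; exact: cfs.
by move=> /filter_ex [n /= hn]; exists (mus n).
Qed.

Lemma tau_le_mu mu A f : measurable (A : set (Borel X)) -> continuous f ->
  (forall x, 0 <= f x <= 1) -> (forall x, f x != 0 -> A x) ->
  ((tau mu f)%:E <= mu (A : set (Borel X)))%E.
Proof.
move=> mA cf f01 fA; rewrite tau_EFin//.
have -> : mu (A : set (Borel X)) =
    (\int[mu]_(x in [set: Borel X]) (\1_(A : set (Borel X)) x)%:E)%E.
  by rewrite integral_indic// setIT.
apply: ge0_le_integral => //.
- by move=> x _; rewrite lee_fin; case/andP: (f01 x).
- by apply/measurable_EFinP; exact: measurable_cont.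
- by apply/measurable_EFinP; apply: measurable_indic.
- move=> x _; rewrite lee_fin indicE; have [->|/fA Ax] := eqVneq (f x) 0.
    by rewrite ler0n.
  by rewrite mem_set//; case/andP: (f01 x).
Qed.

Definition null A := forall mu, Delta mu -> mu (A : set (Borel X)) = 0%E.

(** Otherwise some mu_k in [Delta] violates the bound for each k. A weak* limit mu in [Delta] then
    gives mass at least e to every {|g| < 1/(k+1)}, although these sets decrease to the null set {g
    = 0}. *)
Lemma uniform_hat_small g (e : R) : continuous g -> null [set x | (g x = 0)%R] -> 0 < e ->
  exists k, forall mu, Delta mu -> tau mu (hat k.+1%:R^-1 g) <= e.
Proof.
move=> cg g0 e0; apply: contrapT => H.
have Po : ProperFilter omega by have [Uo _] := homega; exact: ultra_proper.
have {}H k : exists mu, Delta mu /\ e < tau mu (hat k.+1%:R^-1 g).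
  apply: contrapT => nk; apply: H; exists k => mu Dmu; rewrite leNgt.
  by apply/negP => lt; apply: nk; exists mu.
have [mus musP] := choice H.
have [mu Dmu lim] := weak_star_limit (fun n => (musP n).1).
have cb k := @hat_continuous _ _ k.+1%:R^-1 _ cg.
have hat_dec k n x : (k <= n)%N -> hat n.+1%:R^-1 g x <= hat k.+1%:R^-1 g x.
  move=> kn; rewrite /hat !invrK ge_max le_max lexx/= le_max; apply/orP; right.
  by rewrite lerD2l lerN2 ler_wpM2l// ler_nat.
(* For fixed k and all n >= k the narrower n-th tent lies below the k-th one, so the lower bound e
   holds along [omega] and passes to the limit. *)
have ge_e k : e <= tau mu (hat k.+1%:R^-1 g).
  apply: (is_ulim_le Po (is_ulim_cst Po e) (lim _ (cb k))).
  apply: filterS (free_ultra_ge homega k) => n /= kn.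
  apply: (le_trans (ltW (musP n).2)); apply: (state_le (tau_state cX (mus n))) => // x.
  exact: hat_dec.
pose F k : set (Borel X) := [set x | `|g x| * k.+1%:R < 1].
have mF k : measurable (F k).
  apply: open_Borel; have -> : F k = [set x | 0 < 1 - `|g x| * k.+1%:R].
    by apply/seteqP; split => x /=; rewrite subr_gt0.
  apply: open_gt_fun; apply: contB; first exact: contC.
  by apply: contM; [exact: cont_norm|exact: contC].
have capF : \bigcap_k F k = [set x | g x = 0].
  apply/seteqP; split => [x Fx|x /= gx k _]; last by rewrite /F /= gx normr0 mul0r.
  apply/eqP; rewrite -normr_eq0; apply: contrapT => /negP gx.
  have {}gx : 0 < `|g x| by rewrite lt_neqAle eq_sym gx normr_ge0.
  have := Fx (Num.truncn `|g x|^-1) I; rewrite /F /= -ltr_pdivlMl// mulr1.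
  by rewrite ltNge (ltW (truncnS_gt _)).
have F0 : (mu \o F) @ \oo --> 0%E.
  have := g0 mu Dmu; rewrite -capF => <-; apply: nonincreasing_cvg_mu => //.
  - exact: le_lt_trans (probability_le1 mu (mF 0%N)) (ltry _).
  - by rewrite capF; apply: closed_Borel; exact: closed_zeros.
  - move=> m n mn; apply/subsetPset => x; apply: le_lt_trans.
    by rewrite ler_wpM2l// ler_nat.
have main k : (e%:E <= (mu \o F) k)%E.
  apply: (@le_trans _ _ (tau mu (hat k.+1%:R^-1 g))%:E); first by rewrite lee_fin.
  apply: tau_le_mu => // x; first by rewrite hat_ge0 hat_le1.
  rewrite /hat invrK /F /=; case: (leP 0 (1 - `|g x| * k.+1%:R)) => [y0 yn0|_];
    last by rewrite eqxx.
  by rewrite -subr_gt0 lt_neqAle eq_sym yn0.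
have : (e%:E <= limn (mu \o F))%E.
  apply: lime_ge; first by apply/cvg_ex; exists 0%E.
  by apply: filterS filterT => n _; exact: main.
by rewrite (cvg_lim _ F0)// lee_fin leNgt e0.
Qed.

End SmallBoundary.

(** * From small boundaries to invertible approximation *)

Section Construction.
Context {R : realType} {X : pseudoPMetricType R} (cX : compact [set: X]).
Context {omega : set_system nat} (homega : free_ultrafilter omega).
Context {Delta : set (bprob X)} (hDelta : weak_star_closed Delta).
Implicit Types (mu : bprob X) (f g : X -> R) (A W : set X).
Local Notation null := (@null R X Delta).

Lemma omega_filter : Filter omega.
Proof. by have [Uo _] := homega; have [] : ProperFilter omega by exact: ultra_proper. Qed.

Lemma null_subset (A B : set X) : measurable (A : set (Borel X)) ->
  measurable (B : set (Borel X)) -> A `<=` B -> null B -> null A.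
Proof.
move=> mA mB AB B0 mu Dmu; apply/eqP; rewrite eq_le measure_ge0 andbT -(B0 mu Dmu).
by apply: le_measure => //; rewrite inE.
Qed.

Lemma bdry_Borel A : measurable (bdry A : set (Borel X)).
Proof.
apply: measurableD; first by apply: closed_Borel; exact: closed_closure.
by apply: open_Borel; exact: open_interior.
Qed.

Lemma null_bdryU (A B : set X) : null (bdry A) -> null (bdry B) -> null (bdry (A `|` B)).
Proof.
move=> A0 B0; apply: (@null_subset _ (bdry A `|` bdry B)).
- exact: bdry_Borel.
- by apply: measurableU; exact: bdry_Borel.
- rewrite /bdry closureU => x [cAB iAB].
  by case: cAB => c; [left|right]; split => // i; apply: iAB; apply: interiorU; [left|right].
- move=> mu Dmu; apply/eqP; rewrite eq_le measure_ge0 andbT.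
  apply: (le_trans (measureU2 _ (bdry_Borel A) (bdry_Borel B))).
  by rewrite [X in (X + _)%E](A0 mu Dmu) [X in (_ + X)%E](B0 mu Dmu) adde0.
Qed.

(** The compact set {f >= 0} is covered by finitely many neighbourhoods with null boundary inside {f
    > -eta}, and null boundaries survive finite unions. *)
Lemma separating_open f eta : small_boundary_property Delta -> continuous f -> 0 < eta ->
  exists W, [/\ open W, forall x, 0 <= f x -> W x, forall x, W x -> - eta < f x &
    null (bdry W)].
Proof.
move=> sbp cf eta0; pose U := [set x | - eta < f x].
have oU : open U by exact: open_gt_fun.
have VP (x : X) : exists V : set X, U x ->
    [/\ open V, V x, V `<=` U & null (bdry V)].
  have [Ux|nU] := pselect (U x); last by exists set0.
  by have [V [V1 V2 V3 V4]] := sbp x U oU Ux; exists V.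
have [V HV] := choice VP.
have cK : compact [set x | 0 <= f x].
  by apply: (subclosed_compact _ cX) => //; exact: closed_ge_fun.
rewrite compact_cover in cK.
have [||D' D'U cov] := cK _ U V.
- by move=> x /HV [].
- move=> x /= fx; have Ux : U x by rewrite /U /= (lt_le_trans _ fx)// oppr_lt0.
  by exists x => //; case: (HV x Ux).
rewrite /cover bigcup_fset in cov.
pose W (s : seq X) := \big[setU/set0]_(x <- s) V x.
exists (W (finmap.enum_fset D')).
suff [oW WU W0] : [/\ open (W (finmap.enum_fset D')), W (finmap.enum_fset D') `<=` U &
    null (bdry (W (finmap.enum_fset D')))].
  by split => // x fx; exact: cov.
have {}D'U i : i \in finmap.enum_fset D' -> U i by move=> /D'U /set_mem.
rewrite /W; move: (finmap.enum_fset D') D'U => s.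
elim: s => [_|x s IH sU].
  rewrite big_nil; split; [exact: open0|exact: sub0set|].
  by move=> mu _; rewrite /bdry closure0 set0D measure0.
have [|o1 o2 o3] := IH; first by move=> i si; apply: sU; rewrite in_cons si orbT.
have [v1 _ v2 v3] := HV x (sU x (mem_head x s)).
rewrite big_cons; split; [exact: openU|by rewrite subUset|exact: null_bdryU].
Qed.

(** The distance to the complement of [W] minus the distance to [W] is positive exactly on [W] and
    vanishes exactly on its boundary. *)
Lemma separating_function f eta : small_boundary_property Delta -> continuous f -> 0 < eta ->
  exists g, [/\ continuous g, forall x, 0 < g x -> - eta < f x,
    forall x, g x < 0 -> f x < 0 & null [set x | (g x = 0)%R]].
Proof.
move=> sbp cf eta0; have [W [oW fW Wf W0]] := separating_open sbp cf eta0.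
have gW x : W x -> 0 < tdist (~` W) x /\ tdist W x = 0.
  by move=> Wx; split; [apply/(open_tdist_gt0 oW)|apply/tdist_eq0; exact: subset_closure].
have gNW x : ~ W x -> tdist (~` W) x = 0.
  by move=> nWx; apply/tdist_eq0; exact: subset_closure.
have cg : continuous (fun x => tdist (~` W) x - tdist W x).
  by apply: contB; exact: tdist_continuous.
exists (fun x => tdist (~` W) x - tdist W x); split => // [x|x|].
- have [/Wf//|/gNW ->] := pselect (W x).
  by have := tdist_ge0 W x; lra.
- have [/gW [g1 ->]|nW _] := pselect (W x); first lra.
  by rewrite ltNge; apply/negP => /fW.
- apply: (null_subset _ _ _ W0); [|exact: bdry_Borel|].
    by apply: closed_Borel; exact: closed_zeros.
  move=> x /=; have [/gW [g1 ->]|nW] := pselect (W x); first lra.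
  rewrite (gNW _ nW) sub0r => /eqP; rewrite oppr_eq0 => /eqP /tdist_eq0 cW.
  by split => // /interior_subset.
Qed.

(** * Sequences that stabilize away from a null zero set *)

Section StableSequences.
Context {g : X -> R} (cg : continuous g) (g0 : null [set x | (g x = 0)%R]).

Lemma tau_abs2_small (e K : R) : 0 < e -> 0 < K -> exists N, forall h, ccontinuous h ->
  (forall x, abs2 (h x) <= K) -> (forall x, N.+1%:R^-1 <= `|g x| -> h x = 0) ->
  forall mu, Delta mu -> tau mu (fun x => abs2 (h x)) <= e.
Proof.
move=> e0 K0; have e1 : 0 < e / (2 * K) by rewrite divr_gt0// mulr_gt0.
have [k Hk] := uniform_hat_small cX homega hDelta cg g0 e1.
(* Here 1/(N+1) is half of 1/(k+1): where h may be nonzero the tent is at least 1/2, so |h|^2 <= K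
   is at most 2K times the tent. *)
exists (2 * k).+1 => h ch hK h0 mu Dmu; have sT := tau_state cX mu.
have ch2 := @hat_continuous _ _ k.+1%:R^-1 _ cg.
apply: (@le_trans _ _ (tau mu (fun x => (2 * K) * hat k.+1%:R^-1 g x))).
  apply: (state_le sT); first exact: ccont_abs2.
    by apply: contM => //; exact: contC.
  move=> x; have [gx|gx] := leP (2 * k).+2%:R^-1 `|g x|.
    rewrite h0// /abs2 /= expr0n addr0 mulr_ge0 ?hat_ge0//.
    by rewrite mulr_ge0// ltW.
  apply: (le_trans (hK x)); rewrite mulrAC -ler_pdivrMr// divff ?gt_eqF//.
  rewrite /hat invrK; suff : `|g x| * k.+1%:R <= 2^-1.
    by move=> H; rewrite -ler_pdivrMl// mulr1 le_max; apply/orP; right; lra.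
  have : (2 * k).+2%:R = 2 * k.+1%:R :> R by rewrite -natrM mulnS.
  move=> H; rewrite H in gx; rewrite -ler_pdivlMr// -invfM; exact: ltW.
rewrite (stateZ sT)// mulrC -ler_pdivlMr ?mulr_gt0//; exact: Hk.
Qed.

(** From index N on, nothing changes where |g| >= 1/(N+1). With a uniform bound this yields 2-norm
    Cauchy sequences that need not converge uniformly, such as approximations of the sign of g. *)
Definition stable (u : nat -> X -> R) := forall N m n x, (N <= m)%N -> (N <= n)%N ->
  N.+1%:R^-1 <= `|g x| -> u m x = u n x.

(** Late differences are bounded by 2M and live on {|g| < 1/(N+1)}, so [tau_abs2_small] applies; its
    tolerance is (e/2)^2 because [norm2D] takes a root. *)
Lemma stable_in_closure_alg (u : nat -> X -> R) M : 0 < M -> (forall n, continuous (u n)) ->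
  (forall n x, `|u n x| <= M) -> stable u ->
  in_closure_alg Delta (fun n x => (u n x)%:C%C).
Proof.
move=> M0 cu uM su.
have abs2u r : abs2 (r%:C%C : R[i]) = r ^+ 2 by rewrite /abs2 /= expr0n addr0.
split.
  apply: (@linfty_bounded _ _ _ (M ^+ 2)) => [n|n x]; first exact: ccont_real.
  by rewrite abs2u -normr_sqr lerXn2r ?nnegrE ?(ltW M0).
move=> e e0; have e2 : 0 < e / 2 by rewrite divr_gt0.
have e22 : 0 < (e / 2) ^+ 2 by rewrite exprn_gt0.
have K0 : 0 < (2 * M) ^+ 2 by rewrite exprn_gt0// mulr_gt0.
have [N HN] := tau_abs2_small e22 K0.
exists N => m n Nm Nn; apply: (@le_lt_trans _ _ (e / 2)); last lra.
apply: sup_le_nneg; first exact: ltW.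
move=> _ [mu Dmu <-]; rewrite -(ger0_norm (ltW e2)) -sqrtr_sqr ler_wsqrtr//.
apply: HN => //.
- by apply: ccontB; exact: ccont_real.
- move=> x; rewrite -rmorphB abs2u -normr_sqr lerXn2r ?nnegrE ?mulr_ge0 ?(ltW M0)//.
  by apply: (le_trans (ler_normB _ _)); rewrite mulr_natl mulr2n lerD.
- by move=> x gx; rewrite (su N m n)// subrr.
Qed.

Lemma stable_inJ (u : nat -> X -> R) M : 0 < M -> (forall n, continuous (u n)) ->
  (forall n x, `|u n x| <= M) ->
  (forall n x, n.+1%:R^-1 <= `|g x| -> u n x = 0) ->
  inJ omega Delta (fun n x => (u n x)%:C%C).
Proof.
move=> M0 cu uM u0.
have abs2u r : abs2 (r%:C%C : R[i]) = r ^+ 2 by rewrite /abs2 /= expr0n addr0.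
have uM2 n x : abs2 ((u n x)%:C%C) <= M ^+ 2.
  by rewrite abs2u -normr_sqr lerXn2r ?nnegrE ?(ltW M0).
split; first by apply: linfty_bounded uM2 => n; exact: ccont_real.
move=> e e0; have e2 : 0 < e / 2 by rewrite divr_gt0.
have K0 : 0 < M ^+ 2 by rewrite exprn_gt0.
have [N HN] := tau_abs2_small e2 K0.
have Fo := omega_filter.
apply: filterS (free_ultra_ge homega N) => n /= Nn.
rewrite subr0 ger0_norm; last by apply: sup_tau2_ge0 => //; exact: ccont_real.
apply: (@le_lt_trans _ _ (e / 2)); last lra.
apply: sup_tau2_le => [|mu Dmu]; first exact: ltW.
apply: HN => //; first exact: ccont_real.
move=> x gx; rewrite u0//; apply: le_trans gx.
by rewrite lef_pV2 ?posrE// ler_nat.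
Qed.

End StableSequences.

Lemma inJ0 : inJ omega Delta (fun _ _ => 0).
Proof.
have abs20 : abs2 (0 : R[i]) = 0 by rewrite /abs2 /= expr0n addr0.
have c0 : ccontinuous (fun _ : X => 0 : R[i]) by split => /=; exact: contC.
split; first by apply: (@linfty_bounded _ _ _ 0) => // n x; rewrite abs20.
have Fo := omega_filter.
move=> e e0; apply: filterS filterT => n _ /=.
rewrite subr0 ger0_norm; last exact: sup_tau2_ge0.
apply: le_lt_trans e0; apply: sup_tau2_le => // mu _.
by apply: (tau_abs2_le cX) => // x; rewrite abs20.
Qed.

(** The zero sequence is an admissible competitor in the infimum defining the quotient norm. *)
Lemma qnorm_le (a : cseq X) (M : R) : 0 <= M -> (forall n x, cabs (a n x) <= M) ->
  qnorm omega Delta a <= M.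
Proof.
move=> M0 aM; pose z : cseq X := fun _ _ => 0.
have qz : qnorm omega Delta a <= supnorm (Defs.cadd a z).
  apply: ge_inf; last by exists z => //; exact: inJ0.
  exists 0 => _ [j _ <-]; apply: sup_ge0_nneg => _ [p _ <-]; exact: cabs_ge0.
apply: (le_trans qz).
by apply: sup_le_nneg => // _ [p _ <-]; rewrite /Defs.cadd addr0.
Qed.

(* With [g] as in [separating_function] and [s_n] the truncation of [n g] to [[-1, 1]],
   [b_n = f + 2 eta s_n] satisfies [|b_n| >= eta] except where [|g|] is small. *)
Lemma small_boundary_approx f (e : R) : small_boundary_property Delta ->
  continuous f -> 0 < e ->
  exists b : cseq X, sa_invertible omega Delta b /\
    qnorm omega Delta (csub (cconst f) b) < e.
Proof.
(* The perturbation of f has size at most 2 eta = 2e/3 < e. *)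
move=> sbp cf e0; pose eta := e / 3; have eta0 : 0 < eta by rewrite divr_gt0.
have [g [cg gpos gneg g0]] := separating_function sbp cf eta0.
have [M M0 fM] := compact_bounded_fun cX cf.
pose s (n : nat) x : R := Num.max (-1) (Num.min 1 (n.+1%:R * g x)).
have cs n : continuous (s n).
  apply: cont_max; first exact: contC.
  apply: cont_min; first exact: contC.
  by apply: contM => //; exact: contC.
have s_bound n x : `|s n x| <= 1.
  rewrite ler_norml le_max lexx/= ge_max ge_min lexx/= andbT; lra.
have s_sat N n x : (N <= n)%N -> N.+1%:R^-1 <= `|g x| ->
    (0 < g x -> s n x = 1) /\ (g x < 0 -> s n x = -1).
  move=> Nn gx; have ng : 1 <= n.+1%:R * `|g x|.
    rewrite -ler_pdivrMl// mulr1; apply: le_trans gx.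
    by rewrite lef_pV2 ?posrE// ler_nat.
  split=> gs.
    by rewrite gtr0_norm// in ng; rewrite /s (min_idPl _)// (max_idPr _)//; lra.
  rewrite ltr0_norm// mulrN in ng; rewrite /s (min_idPr _); last lra.
  by rewrite (max_idPl _)//; lra.
have s_stable : stable (g := g) s.
  move=> N m n x Nm Nn gx; have [mp mn] := s_sat N m x Nm gx.
  have [np nn] := s_sat N n x Nn gx; have [gp|gn|gz] := ltgtP 0 (g x).
  - by rewrite mp ?np.
  - by rewrite mn ?nn.
  - by move: gx; rewrite -gz normr0 leNgt invr_gt0 ltr0n.
pose b n x : R := f x + 2 * eta * s n x.
have cb n : continuous (b n).
  by apply: contD => //; apply: contM => //; exact: contC.
have b_big n x : n.+1%:R^-1 <= `|g x| -> eta ^+ 2 <= b n x ^+ 2.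
  move=> gx; have [sp sn] := s_sat n n x (leqnn n) gx.
  suff : eta <= `|b n x|.
    by move=> H; rewrite -(normr_sqr (b n x)) lerXn2r ?nnegrE ?(ltW eta0).
  (* Where g > 0, f > -eta is raised by 2 eta to above eta; where g < 0, f < 0 is lowered to below
     -2 eta. *)
  rewrite /b; have [gp|gn|gz] := ltgtP 0 (g x).
  - rewrite sp//; have := gpos x gp; rewrite ler_normr => ?; apply/orP; left; lra.
  - rewrite sn//; have := gneg x gn; rewrite ler_normr => ?; apply/orP; right; lra.
  - by move: gx; rewrite -gz normr0 leNgt invr_gt0 ltr0n.
(* Bounding the denominator below by eta^2 makes b/q continuous everywhere, and equal to 1/b
   wherever b^2 >= eta^2. *)
pose q n x : R := Num.max (b n x ^+ 2) (eta ^+ 2).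
have q0 n x : 0 < q n x by rewrite lt_max [X in _ || X]exprn_gt0 ?orbT.
pose c n x : R := b n x / q n x.
have cc n : continuous (c n).
  apply: contM => //; apply: contV => [|x]; last by rewrite gt_eqF.
  by apply: cont_max; [exact: contX|exact: contC].
have b_bound n x : `|b n x| <= M + 2 * eta.
  apply: (le_trans (ler_normD _ _)); rewrite lerD// normrM.
  by rewrite gtr0_norm ?mulr_gt0// ger_pMr ?mulr_gt0.
have c_bound n x : `|c n x| <= eta^-1.
  rewrite /c normrM normfV (gtr0_norm (q0 n x)) ler_pdivrMr// mulrC ler_pdivlMr//.
  have [be|eb] := leP `|b n x| eta.
    apply: (@le_trans _ _ (eta ^+ 2)); first by rewrite expr2 ler_pM2r.
    by rewrite /q le_max lexx orbT.
  apply: (@le_trans _ _ (b n x ^+ 2)); last by rewrite /q le_max lexx.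
  by rewrite -normr_sqr expr2 ler_pM// ltW.
have b_stable : stable (g := g) b.
  by move=> N m n x Nm Nn gx; rewrite /b (s_stable N m n x).
have c_stable : stable (g := g) c.
  by move=> N m n x Nm Nn gx; rewrite /c /q (b_stable N m n x).
have e20 : 0 < M + 2 * eta by rewrite addr_gt0// mulr_gt0.
have ei0 : 0 < eta^-1 by rewrite invr_gt0.
pose bC : cseq X := fun n x => (b n x)%:C%C.
pose cC : cseq X := fun n x => (c n x)%:C%C.
have bcJ : inJ omega Delta (csub (cmul bC cC) (cone (X := X))).
  have -> : csub (cmul bC cC) (cone (X := X)) = fun n x => (b n x * c n x - 1)%:C%C.
    by apply/funext => n; apply/funext => x; rewrite rmorphB rmorphM rmorph1.
  (* The product is b^2/q, which lies in [0, 1] and equals 1 off {|g| < 1/(n+1)}; its defect from 1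
     is thus in the scope of [stable_inJ]. *)
  have bc01 n x : 0 <= b n x * c n x <= 1.
    rewrite /c mulrA -expr2 divr_ge0 ?sqr_ge0 ?(ltW (q0 n x))//=.
    by rewrite ler_pdivrMr// mul1r /q le_max lexx.
  apply: (stable_inJ cg g0 (M := 1)) => // [n|n x|n x gx].
  - by apply: contB; [exact: contM|exact: contC].
  - by have := bc01 n x; rewrite ler_norml; lra.
  - have := b_big n x gx => /max_idPl qE; rewrite /c /q qE mulrA -expr2 divff ?subrr//.
    by rewrite gt_eqF// -qE; exact: q0.
exists bC; split; last first.
  apply: (@le_lt_trans _ _ (2 * eta)); last by rewrite /eta; lra.
  apply: qnorm_le => [|n x]; first by rewrite mulr_ge0// ltW.
  rewrite /csub /cconst /bC -rmorphB /cabs /abs2 /= expr0n addr0 sqrtr_sqr.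
  rewrite /b opprD addNKr normrN normrM gtr0_norm ?mulr_gt0//.
  by rewrite ger_pMr ?mulr_gt0.
split.
- exact: stable_in_closure_alg e20 cb b_bound b_stable.
- have -> : csub bC (cstar bC) = fun _ _ => 0; last exact: inJ0.
  apply/funext => n; apply/funext => x.
  by rewrite /csub /cstar /bC /conjc /= oppr0 subrr.
- have cbC : cmul cC bC = cmul bC cC.
    by apply/funext => n; apply/funext => x; rewrite /cmul mulrC.
  exists cC; split; [|exact: bcJ|by rewrite cbC; exact: bcJ].
  exact: stable_in_closure_alg ei0 cc c_bound c_stable.
Qed.

End Construction.

Unset Implicit Arguments.

Theorem theorem2p16 (R : realType) (X : pseudoPMetricType R)
  (hX : hausdorff_space X) (cX : compact [set: X])
  (omega : set_system nat) (homega : free_ultrafilter omega)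
  (Delta : set (bprob X)) (hDelta : weak_star_closed Delta) :
  (small_boundary_property Delta ->
     forall f : X -> R, continuous f -> forall e : R, 0 < e ->
       exists b : cseq X, sa_invertible omega Delta b /\
         qnorm omega Delta (csub (cconst f) b) < e)
  /\
  ((forall f : X -> R, continuous f -> forall e : R, 0 < e ->
       exists b : cseq X, sa_invertible omega Delta b /\
         norm2w omega Delta (csub (cconst f) b) < e) ->
     small_boundary_property Delta).
Proof.
split=> [sbp f cf e e0|H].
  exact: small_boundary_approx.
exact: approximable2_small_boundary H.
Qed.
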